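(* Let $\mathcal{H}=\mathbb{C}^2$, let $$C_1=\begin{pmatrix}1&0\\0&2\end{pmatrix},\qquad C_2=\begin{pmatrix}2&1\\1&2\end{pmatrix},\qquad A=C_1^2-I,\qquad B=C_2^2-I,$$ and let $(T_1,T_2)$ be the operator-valued weighted shift on $\ell^2_{\mathbb{Z}_+^2}(\mathcal{H})$ with weights $$W^{(1)}_{m,n}=\big[(m+1)A+nB+I\big]^{1/2}\big[mA+nB+I\big]^{-1/2},\qquad W^{(2)}_{m,n}=\big[mA+(n+1)B+I\big]^{1/2}\big[mA+nB+I\big]^{-1/2}$$ for $(m,n)\in\mathbb{Z}_+^2$. Then $(T_1,T_2)$ is a toral $2$-isometry whose initial weights $W^{(1)}_{0,0}=C_1$ and $W^{(2)}_{0,0}=C_2$ are positive and do not commute, and its toral Cauchy dual $(T_1',T_2')$ is not jointly subnormal.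
   Context: $\mathbb{Z}_+$ is the set of nonnegative integers, $B(\mathcal{H})$ the algebra of bounded linear operators on $\mathcal{H}$. $\ell^2_{\mathbb{Z}_+^2}(\mathcal{H})=\bigoplus_{(m,n)\in\mathbb{Z}_+^2}\mathcal{H}\cong\ell^2(\mathbb{Z}_+^2)\otimes\mathcal{H}$, with $e_{m,n}\otimes h$ denoting the element having $h$ in coordinate $(m,n)$ and $0$ elsewhere. The operator-valued weighted shift with weights $W^{(j)}_{m,n}\in B(\mathcal{H})$ is the pair $(T_1,T_2)$ with $T_1(e_{m,n}\otimes h)=e_{m+1,n}\otimes W^{(1)}_{m,n}h$ and $T_2(e_{m,n}\otimes h)=e_{m,n+1}\otimes W^{(2)}_{m,n}h$. A commuting pair $(T_1,T_2)$ is a toral $2$-isometry if $I-T_i^*T_i-T_j^*T_j+T_j^*T_i^*T_iT_j=0$ for all $i,j\in\{1,2\}$ (including $i=j$); then each $T_i^*T_i$ is invertible. The toral Cauchy dual is $(T_1',T_2')$ with $T_j':=T_j(T_j^*T_j)^{-1}$. A commuting pair $(S_1,S_2)$ on a Hilbert space $\mathcal{L}$ is jointly subnormal if there are a Hilbert space $\mathcal{K}\supseteq\mathcal{L}$ and commuting normal operators $N_1,N_2\in B(\mathcal{K})$ such that $\mathcal{L}$ is invariant under each $N_j$ and $S_j=N_j|_{\mathcal{L}}$ for $j=1,2$. *)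

(* Defs.v *)
From HB Require Import structures.
From mathcomp Require Import all_boot all_order all_algebra finmap complex.
From mathcomp Require Import all_classical all_reals.
From mathcomp Require Import ereal topology normedtype esum showcase.summability.
From mathcomp Require Import ring lra.

Set Implicit Arguments.
Unset Strict Implicit.
Unset Printing Implicit Defensive.

Import Order.TTheory GRing.Theory Num.Theory.
Import numFieldNormedType.Exports.

Local Open Scope classical_set_scope.
Local Open Scope ring_scope.

(* A Hilbert space is a complete normed space over R[i] whose norm comes from an
   inner product, linear in its first argument and conjugate-linear in its
   second one. *)
HB.mixin Record NormedModule_isHilbert (R : realType) H of
    NormedModule R[i] H := {
  dotp : {dot H for Num.conj};
  sqr_normE : forall x, `|x| ^+ 2 = dotp x x
}.

#[short(type="hilbertType")]
HB.structure Definition Hilbert (R : realType) :=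
  {H of NormedModule_isHilbert R H & CompleteNormedModule R[i] H}.

Section DotNorm.
Context {C : numClosedFieldType} {U : lmodType C} (f : {dot U for Num.conj}).

Lemma dot_CauchySchwarz u v : `|f u v| ^+ 2 <= f u u * f v v.
Proof.
have [->|v0] := eqVneq v 0; first by rewrite !linear0r normr0 expr0n mulr0.
have fv : 0 < f v v by rewrite dnorm_gt0.
have fvc : (f v v)^* = f v v by exact/conj_Creal/gtr0_real.
have := dnorm_ge0 f (u - (f u v / f v v) *: v).
rewrite dnormB dnormZ linearZr_LR /= normf_div (gtr0_norm fv) rmorphM /= fmorphV /= fvc.
have -> : (f u v)^* / f v v * f u v = `|f u v| ^+ 2 / f v v.
  by rewrite normCK mulrAC [(f u v)^* * _]mulrC.
have -> : (`|f u v| ^+ 2 / f v v)^* = `|f u v| ^+ 2 / f v v.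
  by apply/conj_Creal/ger0_real; rewrite divr_ge0 ?exprn_ge0// ltW.
have -> : (`|f u v| / f v v) ^+ 2 * f v v = `|f u v| ^+ 2 / f v v.
  by field; rewrite gt_eqF.
by rewrite opprD addrA addrK subr_ge0 ler_pdivrMr.
Qed.

Lemma dot_triangle u v : sqrtC (f (u + v) (u + v)) <= sqrtC (f u u) + sqrtC (f v v).
Proof.
rewrite -ler_sqr ?nnegrE ?addr_ge0 ?sqrtC_ge0 ?dnorm_ge0// sqrrD !sqrtCK dnormD.
rewrite addrAC lerD2r lerD2l.
have le1 : `|f u v| <= sqrtC (f u u) * sqrtC (f v v).
  rewrite -ler_sqr ?nnegrE ?mulr_ge0 ?sqrtC_ge0 ?dnorm_ge0//.
  by rewrite exprMn !sqrtCK dot_CauchySchwarz.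
have -> : f u v + (f u v)^* = 'Re (f u v) *+ 2.
  by rewrite ReE -mulr_natr divfK ?pnatr_eq0.
by rewrite lerMn2r /=; apply: le_trans le1; rewrite leif_Re_Creal.
Qed.

End DotNorm.

Section Sums.
Context {R : realType} {I : choiceType}.
#[local] Existing Instance totally_filter.

Lemma partial_sumE (V : zmodType) (x : I -> V) A :
  partial_sum x A = \sum_(i <- A) x i.
Proof. by rewrite big_seq_fsetE. Qed.

Lemma le_partial_sum (x : I -> R) (A B : {fset I}) :
  (forall i, 0 <= x i) -> (A `<=` B)%fset -> partial_sum x A <= partial_sum x B.
Proof.
move=> x0 AB; rewrite !partial_sumE.
have -> : \sum_(i <- A) x i = \sum_(i <- B) (if i \in A then x i else 0).
  rewrite -(big_fset_incl _ AB) => [|i _ /negPf ->//].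
  by apply: eq_big_seq => i ->.
by apply: ler_sum => i _; case: ifP.
Qed.

Lemma cvg_partial_sum_ge0 (x : I -> R) M : (forall i, 0 <= x i) ->
  (forall A, partial_sum x A <= M) ->
  partial_sum x @ totally --> sup (range (partial_sum x)).
Proof.
move=> x0 xM.
have hs : has_sup (range (partial_sum x)).
  split; first by exists (partial_sum x fset0); exists fset0.
  by exists M => _ [A _ <-].
apply/cvgrPdist_le => e e0.
have [_ [A _ <-] sA] := sup_adherent e0 hs.
exists A => // B /= AB.
have sB : partial_sum x B <= sup (range (partial_sum x)).
  by apply: ub_le_sup; [case: hs|exists B].
rewrite ger0_norm ?subr_ge0// lerBlDr -lerBlDl.
by apply: (le_trans (ltW sA)); exact: le_partial_sum.
Qed.

Lemma cvg_partial_sum_dom (x y : I -> R) M : (forall i, `|x i| <= y i) ->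
  (forall A, partial_sum y A <= M) -> cvg (partial_sum x @ totally).
Proof.
move=> xy yM.
have y0 i : 0 <= y i by exact: le_trans (xy i).
have cy := cvg_partial_sum_ge0 y0 yM.
have xy0 i : 0 <= x i + y i.
  by have := xy i; rewrite ler_norml => /andP[]; rewrite -subr_ge0 opprK.
have cxy : partial_sum (fun i => x i + y i) @ totally -->
    sup (range (partial_sum (fun i => x i + y i))).
  apply: (@cvg_partial_sum_ge0 _ (M + M)) => // A.
  have -> : partial_sum (fun i => x i + y i) A = partial_sum x A + partial_sum y A.
    by rewrite !partial_sumE big_split.
  apply: lerD => //; apply: le_trans (yM A); rewrite !partial_sumE.
  by apply: ler_sum => i _; apply: le_trans (xy i); rewrite ler_norm.
apply/cvg_ex; eexists.
have -> : partial_sum x = partial_sum (fun i => x i + y i) \- partial_sum y.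
  by apply/funext => A /=; rewrite !partial_sumE -sumrB; apply: eq_bigr => i _; rewrite addrK.
exact: cvgB cxy cy.
Qed.

Lemma normc_le (z : R[i]) : `|z| <= (`|complex.Re z| + `|complex.Im z|)%:C%C.
Proof.
case: z => a b /=.
have -> : (a +i* b)%C = a%:C%C + 'i%C * b%:C%C by apply/eqP; rewrite eq_complex /= !(mul0r,mul1r,subr0,addr0,add0r,oppr0,mulr0,subrr) !eqxx.
apply: le_trans (ler_normD _ _) _.
rewrite normrM !normc_def /= !expr0n /= !addr0 add0r expr1n sqrtr1 mul1r !sqrtr_sqr.
by rewrite lecE /= addr0 eqxx /=.
Qed.

Lemma cvg_complex (T : Type) (F : set_system T) (FF : Filter F)
  (f : T -> R[i]^o) (a b : R) :
  (fun t => complex.Re (f t)) @ F --> a -> (fun t => complex.Im (f t)) @ F --> b ->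
  f @ F --> ((a +i* b)%C : R[i]^o).
Proof.
move=> fa fb; apply/cvgrPdist_le => e e0.
have [e1 e2] : complex.Im e = 0 /\ 0 < complex.Re e.
  by move: e0; rewrite ltcE /= => /andP[/eqP -> ->].
have e3 : 0 < complex.Re e / 2 by rewrite divr_gt0.
move/cvgrPdist_le: fa => /(_ _ e3) fa.
move/cvgrPdist_le: fb => /(_ _ e3) fb.
near=> t.
apply: le_trans (normc_le _) _.
rewrite lecE /= e1 eqxx /= [leRHS]splitr.
have -> : complex.Re ((a +i* b)%C - f t) = a - complex.Re (f t) by case: (f t).
have -> : complex.Im ((a +i* b)%C - f t) = b - complex.Im (f t) by case: (f t).
by apply: lerD; near: t.
Unshelve. all: by end_near. Qed.

End Sums.

Section Cdot.
Context {R : realType} {d : nat}.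
Implicit Types (u v w : 'cV[R[i]]_d) (c : R[i]).

(* The standard inner product of C^d and the square of its norm. *)
Definition cdot v w : R[i] := \sum_k v k 0 * Num.conj (w k 0).
Definition sqnorm v : R := complex.Re (cdot v v).

Lemma cdotC v w : cdot v w = Num.conj (cdot w v).
Proof.
rewrite /cdot rmorph_sum /=; apply: eq_bigr => k _.
by rewrite rmorphM /= conjCK mulrC.
Qed.

Lemma cdotDl c u v w : cdot (c *: u + v) w = c * cdot u w + cdot v w.
Proof.
rewrite /cdot mulr_sumr -big_split /=; apply: eq_bigr => k _.
by rewrite !mxE mulrDl mulrA.
Qed.

Lemma Re_sum (J : Type) (r : seq J) (F : J -> R[i]) :
  complex.Re (\sum_(j <- r) F j) = \sum_(j <- r) complex.Re (F j).
Proof. by elim/big_rec2: _ => // j y1 y2 _ <-; case: y2; case: (F j). Qed.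

Lemma Im_sum (J : Type) (r : seq J) (F : J -> R[i]) :
  complex.Im (\sum_(j <- r) F j) = \sum_(j <- r) complex.Im (F j).
Proof. by elim/big_rec2: _ => // j y1 y2 _ <-; case: y2; case: (F j). Qed.

Lemma sqnormE v :
  sqnorm v = \sum_k (complex.Re (v k 0) ^+ 2 + complex.Im (v k 0) ^+ 2).
Proof.
rewrite /sqnorm /cdot Re_sum; apply: eq_bigr => k _.
by case: (v k 0) => a b /=; ring.
Qed.

Lemma cdotvv v : cdot v v = (sqnorm v)%:C%C.
Proof.
rewrite /sqnorm /cdot; apply/eqP; rewrite eq_complex /= eqxx /= Im_sum big1// => k _.
by case: (v k 0) => a b /=; ring.
Qed.

Lemma sqnorm_ge0 v : 0 <= sqnorm v.
Proof. by rewrite sqnormE sumr_ge0// => k _; rewrite addr_ge0// sqr_ge0. Qed.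

Lemma sqnorm0 : sqnorm 0 = 0.
Proof. by rewrite sqnormE big1// => k _; rewrite mxE /= expr0n addr0. Qed.

Lemma sqnorm_eq0 v : sqnorm v = 0 -> v = 0.
Proof.
rewrite sqnormE => /eqP; rewrite psumr_eq0 => [/allP v0|k _]; last first.
  by rewrite addr_ge0// sqr_ge0.
apply/matrixP => k j; rewrite ord1 mxE.
have := v0 k (mem_index_enum k); rewrite /= paddr_eq0 ?sqr_ge0// !sqrf_eq0.
by case: (v k 0) => a b /= /andP[/eqP -> /eqP ->].
Qed.

Lemma sqnormZ c v :
  sqnorm (c *: v) = (complex.Re c ^+ 2 + complex.Im c ^+ 2) * sqnorm v.
Proof.
rewrite !sqnormE mulr_sumr; apply: eq_bigr => k _; rewrite mxE.
by case: c (v k 0) => a b [x y] /=; ring.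
Qed.

Lemma sqnormD v w : sqnorm (v + w) <= 2 * sqnorm v + 2 * sqnorm w.
Proof.
rewrite !sqnormE !mulr_sumr -big_split /=; apply: ler_sum => k _; rewrite mxE.
case: (v k 0) (w k 0) => a b [x y] /=.
by have := sqr_ge0 (a - x); have := sqr_ge0 (b - y); nra.
Qed.

Lemma Re_cdot_le v w : `|complex.Re (cdot v w)| <= sqnorm v + sqnorm w.
Proof.
rewrite !sqnormE /cdot Re_sum -big_split /=.
apply: le_trans (ler_norm_sum _ _ _) _; apply: ler_sum => k _.
rewrite ler_norml; case: (v k 0) (w k 0) => a b [x y] /=.
have := sqr_ge0 (a - x); have := sqr_ge0 (b - y); have := sqr_ge0 (a - y).
have := sqr_ge0 (a + x); have := sqr_ge0 (b + y); have := sqr_ge0 (a + y).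
have := sqr_ge0 (b - x); have := sqr_ge0 (b + x); have := sqr_ge0 a.
have := sqr_ge0 b; have := sqr_ge0 x; have := sqr_ge0 y.
by rewrite !expr2 => *; apply/andP; split; lra.
Qed.

Lemma Im_cdot_le v w : `|complex.Im (cdot v w)| <= sqnorm v + sqnorm w.
Proof.
rewrite !sqnormE /cdot Im_sum -big_split /=.
apply: le_trans (ler_norm_sum _ _ _) _; apply: ler_sum => k _.
rewrite ler_norml; case: (v k 0) (w k 0) => a b [x y] /=.
have := sqr_ge0 (a - x); have := sqr_ge0 (b - y); have := sqr_ge0 (a - y).
have := sqr_ge0 (a + x); have := sqr_ge0 (b + y); have := sqr_ge0 (a + y).
have := sqr_ge0 (b - x); have := sqr_ge0 (b + x); have := sqr_ge0 a.
have := sqr_ge0 b; have := sqr_ge0 x; have := sqr_ge0 y.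
by rewrite !expr2 => *; apply/andP; split; lra.
Qed.

End Cdot.

Section L2Pred.
Context {R : realType} {I : choiceType} {d : nat}.
Implicit Types f g : I -> 'cV[R[i]]_d.

Definition l2_pred : {pred I -> 'cV[R[i]]_d} :=
  fun f => (\esum_(i in [set: I]) (sqnorm (f i))%:E < +oo)%E.

Lemma l2P f : reflect (exists M, forall A, partial_sum (sqnorm \o f) A <= M)
  (f \in l2_pred).
Proof.
apply: (iffP idP) => [|[M fM]]; last first.
  apply: (@le_lt_trans _ _ M%:E); last exact: ltry.
  apply: ge_ereal_sup => _ [X [fX _] <-].
  rewrite (fsbig_finite _ _ fX) /= sumEFin lee_fin.
  by have := fM (fset_set X); rewrite partial_sumE.
rewrite /l2_pred unfold_in /= => fo.
have s0 : (0 <= \esum_(i in [set: I]) (sqnorm (f i))%:E)%E.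
  by apply: esum_ge0 => i _; rewrite lee_fin sqnorm_ge0.
exists (fine (\esum_(i in [set: I]) (sqnorm (f i))%:E)) => A.
rewrite -lee_fin fineK ?ge0_fin_numE//.
apply: esum_ge; exists [set` A]; first by split.
by rewrite fsbig_finite//= set_fsetK partial_sumE sumEFin.
Qed.

Lemma l2_submod : submod_closed l2_pred.
Proof.
split.
  by apply/l2P; exists 0 => A; rewrite partial_sumE big1// => i _; rewrite /= sqnorm0.
move=> c f g /l2P[M fM] /l2P[N gN]; apply/l2P.
exists (2 * ((complex.Re c ^+ 2 + complex.Im c ^+ 2) * M) + 2 * N) => A.
apply: (@le_trans _ _ (2 * ((complex.Re c ^+ 2 + complex.Im c ^+ 2) *
    partial_sum (sqnorm \o f) A) + 2 * partial_sum (sqnorm \o g) A)).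
  rewrite !partial_sumE !mulr_sumr -big_split /=; apply: ler_sum => i _.
  by rewrite -sqnormZ; exact: sqnormD.
by rewrite lerD// ler_wpM2l// ler_wpM2l// addr_ge0// sqr_ge0.
Qed.

End L2Pred.

HB.instance Definition _ (R : realType) (I : choiceType) d :=
  GRing.isSubmodClosed.Build _ _ (@l2_pred R I d)
    (GRing.submod_closed_semi l2_submod).

(* The Hilbert space direct sum of copies of C^d indexed by I, i.e., the
   square-summable families of vectors of C^d. *)
Record l2 (R : realType) (I : choiceType) (d : nat) :=
  L2 { l2fun :> I -> 'cV[R[i]]_d; _ : l2fun \in @l2_pred R I d }.

Section L2Lmod.
Context {R : realType} {I : choiceType} {d : nat}.
Notation l2 := (l2 R I d).
HB.instance Definition _ := [isSub for @l2fun R I d].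
HB.instance Definition _ := [Choice of l2 by <:].
HB.instance Definition _ := [SubChoice_isSubLmodule of l2 by <:].
End L2Lmod.

Section L2Dot.
Context {R : realType} {I : choiceType} {d : nat}.
#[local] Existing Instance totally_filter.
Notation l2 := (l2 R I d).
Implicit Types f g h : l2.

(* The sum is unconditional (a limit along the finite subsets of I); it converges
   by l2_dot_cvg below. *)
Definition l2_dot f g : R[i] := sum (fun i => cdot (f i) (g i) : R[i]^o).

Lemma l2funP f : exists M, forall A, partial_sum (fun i => sqnorm (f i)) A <= M.
Proof. by case: f => f /= /l2P. Qed.

Lemma l2_dot_cvg f g :
  partial_sum (fun i => cdot (f i) (g i) : R[i]^o) @ totally --> (l2_dot f g : R[i]^o).
Proof.
have [M fM] := l2funP f; have [N gN] := l2funP g.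
have fgMN A : partial_sum (fun i => sqnorm (f i) + sqnorm (g i)) A <= M + N.
  apply: le_trans (lerD (fM A) (gN A)).
  by rewrite !partial_sumE big_split.
have /cvg_ex[a ca] := cvg_partial_sum_dom (fun i => Re_cdot_le (f i) (g i)) fgMN.
have /cvg_ex[b cb] := cvg_partial_sum_dom (fun i => Im_cdot_le (f i) (g i)) fgMN.
suff : cvg (partial_sum (fun i => cdot (f i) (g i) : R[i]^o) @ totally) by [].
apply/cvg_ex; exists (a +i* b)%C; apply: cvg_complex.
  apply: cvg_trans ca; apply: near_eq_cvg; apply: nearW => A.
  by rewrite !partial_sumE Re_sum.
apply: cvg_trans cb; apply: near_eq_cvg; apply: nearW => A.
by rewrite !partial_sumE Im_sum.
Qed.

Lemma l2_dotE f g (z : R[i]^o) :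
  partial_sum (fun i => cdot (f i) (g i) : R[i]^o) @ totally --> z ->
  l2_dot f g = z.
Proof.
move=> fgz; have hC : hausdorff_space R[i]^o by exact: norm_hausdorff.
exact: (cvg_lim hC fgz).
Qed.

Lemma l2_dotvvE f :
  l2_dot f f = (sup (range (partial_sum (fun i => sqnorm (f i)))))%:C%C.
Proof.
have [M fM] := l2funP f.
apply: l2_dotE; apply: cvg_complex.
  apply: cvg_trans (cvg_partial_sum_ge0 (fun i => sqnorm_ge0 (f i)) fM).
  apply: near_eq_cvg; apply: nearW => A.
  by rewrite !partial_sumE Re_sum.
rewrite (_ : (fun _ => _) = cst 0); first exact: cvg_cst.
apply/funext => A; rewrite !partial_sumE Im_sum big1// => i _.
by rewrite cdotvv.
Qed.

Lemma l2_dot_ge f A :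
  (partial_sum (fun i => sqnorm (f i)) A)%:C%C <= l2_dot f f.
Proof.
have [M fM] := l2funP f.
rewrite l2_dotvvE lecR; apply: ub_le_sup; last by exists A.
by exists M => _ [B _ <-].
Qed.

Lemma l2_dot_le f M : (forall A, partial_sum (fun i => sqnorm (f i)) A <= M) ->
  l2_dot f f <= M%:C%C.
Proof.
move=> fM; rewrite l2_dotvvE lecR; apply: ge_sup.
  by exists (partial_sum (fun i => sqnorm (f i)) fset0); exists fset0.
by move=> _ [A _ <-].
Qed.

Lemma l2_dotC f g : l2_dot f g = Num.conj (l2_dot g f).
Proof.
apply: l2_dotE; have := @l2_dot_cvg g f.
move=> /cvgrPdist_le gf; apply/cvgrPdist_le => e e0.
have E (z w : R[i]) : `|Num.conj z - Num.conj w| = `|z - w|.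
  by rewrite -rmorphB norm_conjC.
have := gf e e0; apply: filterS => A; rewrite !partial_sumE.
have -> : \sum_(i <- A) (cdot (f i) (g i) : R[i]^o) =
    Num.conj (\sum_(i <- A) cdot (g i) (f i)).
  by rewrite rmorph_sum; apply: eq_bigr => i _; exact: cdotC.
by rewrite -(E (l2_dot g f)).
Qed.

Lemma l2_dot_linearl h (c : R[i]) f g :
  l2_dot (c *: f + g) h = c * l2_dot f h + l2_dot g h.
Proof.
apply: l2_dotE.
rewrite (_ : partial_sum _ = (fun A => c *: (partial_sum (fun i => cdot (f i) (h i) : R[i]^o) A)
  + partial_sum (fun i => cdot (g i) (h i) : R[i]^o) A)).
  apply: cvgD; last exact: l2_dot_cvg.
  by apply: cvgZ; [exact: cvg_cst|exact: l2_dot_cvg].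
apply/funext => A; rewrite !partial_sumE scaler_sumr -big_split /=.
by apply: eq_bigr => i _; rewrite -cdotDl.
Qed.

Lemma l2_dot_linear : bilinear_for *%R (Num.conj \; *%R) l2_dot.
Proof.
split=> [h|h] c f g; first exact: l2_dot_linearl.
by rewrite !(l2_dotC h) l2_dot_linearl rmorphD rmorphM.
Qed.

HB.instance Definition _ := bilinear_isBilinear.Build R[i] l2 l2 R[i]
  _ _ l2_dot l2_dot_linear.

Lemma l2_dot_herm f g : l2_dot f g = (-1) ^+ false * Num.conj (l2_dot g f).
Proof. by rewrite expr0 mul1r; exact: l2_dotC. Qed.

HB.instance Definition _ := isHermitianSesquilinear.Build R[i] l2 false
  Num.conj l2_dot l2_dot_herm.

Lemma l2_dot_gt0 f : f != 0 -> 0 < l2_dot f f.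
Proof.
move=> f0.
have [i fi] : exists i, f i != 0.
  apply: contrapT => /forallNP fz; move/eqP: f0; apply; apply/val_inj/funext => i /=.
  by apply/eqP/negPn/negP; exact: fz.
apply: lt_le_trans (l2_dot_ge f [fset i]%fset).
rewrite partial_sumE big_seq_fset1 ltcR lt_def sqnorm_ge0 andbT.
by apply: contra fi => /eqP/sqnorm_eq0 ->.
Qed.

HB.instance Definition _ := isDotProduct.Build R[i] l2 l2_dot l2_dot_gt0.

Definition l2_norm f : R[i] := sqrtC (l2_dot f f).

Lemma l2_normD f g : l2_norm (f + g) <= l2_norm f + l2_norm g.
Proof. exact: dot_triangle. Qed.

Lemma l2_normZ (c : R[i]) f : l2_norm (c *: f) = `|c| * l2_norm f.
Proof.
rewrite /l2_norm dnormZ sqrtCM ?nnegrE ?exprn_ge0 ?dnorm_ge0//.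
by rewrite sqrCK.
Qed.

Lemma l2_norm_eq0 f : l2_norm f = 0 -> f = 0.
Proof. by move/eqP; rewrite sqrtC_eq0 dnorm_eq0 => /eqP. Qed.

HB.instance Definition _ :=
  Lmodule_isNormed.Build R[i] l2 l2_normD l2_normZ l2_norm_eq0.

Lemma l2_sqr_normE f : `|f| ^+ 2 = l2_dot f f.
Proof. by rewrite sqrtCK. Qed.

Lemma l2_norm_le f (e : R) : 0 <= e ->
  (forall A, partial_sum (fun i => sqnorm (f i)) A <= e ^+ 2) -> `|f| <= e%:C%C.
Proof.
move=> e0 fe; rewrite -ler_sqr ?nnegrE ?lecR// l2_sqr_normE.
by rewrite -rmorphXn; exact: l2_dot_le.
Qed.

Lemma l2_norm_ge f (e : R) A : `|f| <= e%:C%C ->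
  partial_sum (fun i => sqnorm (f i)) A <= e ^+ 2.
Proof.
move=> fe; rewrite -lecR; apply: le_trans (l2_dot_ge f A) _.
have e0 : 0 <= e%:C%C by exact: le_trans fe.
by rewrite -l2_sqr_normE rmorphXn ler_sqr ?nnegrE.
Qed.

Lemma l2_complete (F : set_system l2) : ProperFilter F -> cauchy F -> cvg F.
Proof.
move=> FF Fc.
have Fe (e : R) : 0 < e -> exists f0, F [set f | `|f0 - f| <= e%:C%C].
  move=> e0; have e0' : 0 < e%:C%C by rewrite ltcR.
  have [f0 Ff0] := (cauchyP F).1 Fc _ e0'.
  by exists f0; apply: filterS Ff0 => f; rewrite -ball_normE /= => /ltW.
have comp (c : l2 -> R) : (forall f g, c (f - g) = c f - c g) ->
    (forall f e, `|f| <= e%:C%C -> `|c f| <= e) -> cvg (c @ F).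
  move=> cB c1; apply: cauchy_cvg; apply: cauchy_exP => e e0.
  have [f0 Ff0] := Fe (e / 2) (divr_gt0 e0 (ltr0n _ 2)).
  exists (c f0); rewrite /nbhs /=; apply: filterS Ff0 => f /= f0f.
  rewrite -ball_normE /= -cB; apply: le_lt_trans (c1 _ _ f0f) _; lra.
have sqn1 f e i k : `|f| <= e%:C%C ->
    complex.Re (f i k 0) ^+ 2 + complex.Im (f i k 0) ^+ 2 <= e ^+ 2.
  move=> fe; apply: le_trans (l2_norm_ge [fset i]%fset fe).
  rewrite partial_sumE big_seq_fset1 sqnormE (bigD1 k)//= lerDl sumr_ge0// => *.
  by rewrite addr_ge0 ?sqr_ge0.
have norm_ge0 f e : `|f| <= e%:C%C :> R[i] -> 0 <= e :> R.
  by move=> fe; rewrite -ler0c; exact: le_trans fe.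
have cRe i k : cvg ((fun f : l2 => complex.Re (f i k 0)) @ F).
  apply: comp => [f g|f e fe]; first by rewrite !mxE; case: (f i k 0) (g i k 0) => a b [].
  have e0 := norm_ge0 _ _ fe.
  rewrite -(ler_sqr (normr_ge0 _) e0) real_normK ?num_real//.
  by apply: le_trans (sqn1 _ _ i k fe); rewrite lerDl sqr_ge0.
have cIm i k : cvg ((fun f : l2 => complex.Im (f i k 0)) @ F).
  apply: comp => [f g|f e fe]; first by rewrite !mxE; case: (f i k 0) (g i k 0) => a b [].
  have e0 := norm_ge0 _ _ fe.
  rewrite -(ler_sqr (normr_ge0 _) e0) real_normK ?num_real//.
  by apply: le_trans (sqn1 _ _ i k fe); rewrite lerDr sqr_ge0.
have /choice[re cre] : forall ik : I * 'I_d, exists l,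
    (fun f : l2 => complex.Re (f ik.1 ik.2 0)) @ F --> (l : R).
  by move=> [i k]; have /cvg_ex := cRe i k.
have /choice[im cim] : forall ik : I * 'I_d, exists l,
    (fun f : l2 => complex.Im (f ik.1 ik.2 0)) @ F --> (l : R).
  by move=> [i k]; have /cvg_ex := cIm i k.
have csq (c : l2 -> R) (a l : R) : c @ F --> l ->
    (fun f => (a - c f) ^+ 2) @ F --> (a - l) ^+ 2.
  move=> cl; have cal : (fun f => a - c f) @ F --> a - l.
    by apply: cvgB => //; exact: cvg_cst.
  exact: (cvgM cal cal).
pose g i : 'cV[R[i]]_d := \col_k (re (i, k) +i* im (i, k))%C.
have cvgS (f0 : l2) A :
    (fun f : l2 => partial_sum (fun i => sqnorm (f0 i - f i)) A) @ F -->
    partial_sum (fun i => sqnorm (f0 i - g i)) A.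
  rewrite partial_sumE.
  rewrite (_ : (fun f : l2 => _) =
      fun f : l2 => \sum_(i <- A) sqnorm (f0 i - f i)); last first.
    by apply/funext => f; rewrite partial_sumE.
  apply: (@cvg_big _ _ +%R 0 _ add_continuous) => i _; rewrite sqnormE.
  rewrite (_ : (fun f : l2 => _) = fun f : l2 => \sum_k
    ((complex.Re (f0 i k 0) - complex.Re (f i k 0)) ^+ 2 +
     (complex.Im (f0 i k 0) - complex.Im (f i k 0)) ^+ 2)); last first.
    apply/funext => f; rewrite sqnormE; apply: eq_bigr => k _; rewrite !mxE.
    by case: (f0 i k 0) (f i k 0) => a b [].
  rewrite (eq_bigr (fun k => (complex.Re (f0 i k 0) - re (i, k)) ^+ 2 +
     (complex.Im (f0 i k 0) - im (i, k)) ^+ 2)); last first.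
    by move=> k _; rewrite !mxE; case: (f0 i k 0).
  apply: (@cvg_big _ _ +%R 0 _ add_continuous) => k _.
  by apply: cvgD; apply: csq; [exact: (cre (i, k))|exact: (cim (i, k))].
have key (e : R) : 0 < e -> exists f0 : l2, F [set f | `|f0 - f| <= e%:C%C] /\
    forall A, partial_sum (fun i => sqnorm (f0 i - g i)) A <= e ^+ 2.
  move=> e0; have [f0 Ff0] := Fe e e0; exists f0; split => // A.
  apply: (cvgr_to_le (cvgS f0 A)).
  apply: filterS Ff0 => f /= f0f.
  exact: (@l2_norm_ge (f0 - f)).
have gl2 : g \in @l2_pred R I d.
  have [f0 [_ f0g]] := key 1 ltr01.
  have h : (fun i => f0 i - g i) \in @l2_pred R I d.
    by apply/l2P; exists (1 ^+ 2).
  rewrite (_ : g = (f0 : I -> _) - (fun i => f0 i - g i)).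
    by rewrite rpredB//; case: f0 {f0g h}.
  by apply/funext => i; rewrite /= fctE opprB addrCA subrr addr0.
apply/cvg_ex; exists (L2 gl2).
apply/cvgrPdist_le => e e0.
have [e1 e2] : complex.Im e = 0 /\ 0 < complex.Re e.
  by move: e0; rewrite ltcE /= => /andP[/eqP -> ->].
have eE : e = (complex.Re e / 2)%:C%C + (complex.Re e / 2)%:C%C.
  by rewrite -rmorphD -splitr; case: (e) e1 => a b /= ->.
have e3 : 0 < complex.Re e / 2 by rewrite divr_gt0.
have [f0 [Ff0 f0g]] := key _ e3.
apply: filterS Ff0 => f /= f0f.
rewrite -(subrK f0 (L2 gl2)) -addrA eE; apply: le_trans (ler_normD _ _) _.
apply: lerD => //; rewrite distrC; apply: l2_norm_le; first exact: ltW.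
exact: f0g.
Qed.

HB.instance Definition _ := Uniform_isComplete.Build l2 l2_complete.
HB.instance Definition _ := NormedModule_isHilbert.Build R l2 l2_sqr_normE.

End L2Dot.

Section L2Single.
Context {R : realType} {I : choiceType} {d : nat}.
Implicit Types (p : I) (h : 'cV[R[i]]_d).

Lemma l2_single_subproof p h :
  (fun i => if i == p then h else 0) \in @l2_pred R I d.
Proof.
apply/l2P; exists (sqnorm h) => A; rewrite partial_sumE /=.
have z (B : {fset I}) : p \notin B ->
    \sum_(i <- B) sqnorm (if i == p then h else 0) = 0.
  move=> pB; rewrite big_seq big1// => i iB; case: eqP => [ip|_].
    by rewrite -ip iB in pB.
  exact: sqnorm0.
have [pA|pA] := boolP (p \in A); last by rewrite z ?sqnorm_ge0.
by rewrite (big_fsetD1 p)//= eqxx z ?addr0// !inE eqxx.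
Qed.

(* The vector e_p \otimes h: h in coordinate p and 0 elsewhere. *)
Definition l2_single p h : l2 R I d := L2 (l2_single_subproof p h).

End L2Single.

Section Operators.
Context {R : realType}.
Implicit Types H K L : hilbertType R.

Definition bounded_op H (T : H -> H) : Prop :=
  linear T /\ exists M : R, forall x, `|T x| <= M%:C%C * `|x|.

(* The Hilbert space adjoint: for a bounded T it exists by the Riesz
   representation theorem and it is unique, so the default value is not used. *)
Definition adj H (T : H -> H) : H -> H :=
  xget (fun=> 0) [set S | forall x y, dotp (T x) y = dotp x (S y)].

(* The inverse of an invertible element of B(H), and 0 otherwise. *)
Definition inv_op H (T : H -> H) : H -> H :=
  xget (fun=> 0) [set S | [/\ bounded_op S, cancel T S & cancel S T]].

Definition normal_op H (N : H -> H) : Prop :=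
  bounded_op N /\ adj N \o N = N \o adj N.

(* The two members of a pair of operators are indexed by 0, 1 : 'I_2. *)
Definition commuting_pair H (T : 'I_2 -> H -> H) : Prop :=
  (forall j, bounded_op (T j)) /\ T 0 \o T 1 = T 1 \o T 0.

Definition toral_2isometry H (T : 'I_2 -> H -> H) : Prop :=
  commuting_pair T /\
  forall (i j : 'I_2) (x : H),
    x - adj (T i) (T i x) - adj (T j) (T j x)
      + adj (T j) (adj (T i) (T i (T j x))) = 0.

Definition cauchy_dual H (T : 'I_2 -> H -> H) : 'I_2 -> H -> H :=
  fun j => T j \o inv_op (adj (T j) \o T j).

(* L is viewed as a subspace of K through the linear isometry V; the range of V
   is complete, hence closed, and the last clause contains its invariance. *)
Definition jointly_subnormal L (S : 'I_2 -> L -> L) : Prop :=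
  exists (K : hilbertType R) (V : L -> K) (N : 'I_2 -> K -> K),
    [/\ linear V /\ (forall x y, dotp (V x) (V y) = dotp x y),
        forall j, normal_op (N j), commuting_pair N &
        forall j x, N j (V x) = V (S j x)].

End Operators.

Section WeightedShift.
Context {R : realType} {d : nat}.

Definition weighted_shift (W1 W2 : nat -> nat -> 'M[R[i]]_d)
    (T : 'I_2 -> l2 R (nat * nat)%type d -> l2 R (nat * nat)%type d) : Prop :=
  [/\ forall j, bounded_op (T j),
      forall m n h,
        T 0 (l2_single (m, n) h) = l2_single (m.+1, n) (W1 m n *m h) &
      forall m n h,
        T 1 (l2_single (m, n) h) = l2_single (m, n.+1) (W2 m n *m h)].

Definition posmx (M : 'M[R[i]]_d) : Prop := forall v, 0 <= cdot (M *m v) v.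

(* The positive square root of a positive matrix (it exists and is unique). *)
Definition sqrtmx (M : 'M[R[i]]_d) : 'M[R[i]]_d :=
  xget 0 [set S | posmx S /\ S *m S = M].

End WeightedShift.

Definition mx22 (F : nmodType) (a b c d : F) : 'M[F]_2 :=
  \matrix_(i, j) nth 0 (nth [::] [:: [:: a; b]; [:: c; d]] i) j.

(* Main.v *)
Require Import Defs.
From mathcomp Require Import all_boot all_order all_algebra finmap complex.
From mathcomp Require Import all_classical all_reals.
From mathcomp Require Import topology normedtype showcase.summability.
From mathcomp Require Import ring lra.

Import Order.TTheory GRing.Theory Num.Theory.
Import numFieldNormedType.Exports.

Set Implicit Arguments.
Unset Strict Implicit.
Unset Printing Implicit Defensive.

Local Open Scope classical_set_scope.
Local Open Scope ring_scope.

(** The weights are quotients of the square roots Q(p) of the matrices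
    D(p) = m A + n B + I, p = (m, n), so that the weights along any lattice path from
    p to q multiply to Q(q) Q(p)^-1.  Hence the pair commutes, and the operator
    that must vanish for a toral 2-isometry is, at p, a second difference of D
    multiplied on both sides by Q(p)^-1; it is 0 because D is affine
    ([block_shift_toral]).  The weights of
    the Cauchy dual multiply to Q(q)^-1 Q(p) ([cauchy_dual_block]).

    Suppose that normal commuting N_1, N_2 extend the Cauchy dual, and let x be the
    vector with e_1 = (1, 0) at the origin.  Since A e_1 = 0, all Q(m, 0) fix e_1, so
    that N_1 is isometric on the orbit of x, and N_1^* N_1 x = x.  On the other hand
    |N_2 x|^2 = <D(0,1)^-1 e_1, e_1> = 5/9, while
    |N_1 N_2 x|^2 = <D(1,1)^-1 e_1, e_1> = 1/3 is strictly smaller.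

    This is impossible ([normal_norm_le]).  Put x_k = N_1^*^k x and w_k = N_2 x_k.
    Then N_1 x_(k+1) = x_k and |x_k| = |x|, so that N_1 w_(k+1) = w_k and the w_k are
    bounded.  For a normal N and any u,
    0 <= |N^* N u - u|^2 = |N^2 u|^2 - 2 |N u|^2 + |u|^2; hence squared norms are
    convex along ..., w_1, w_0, N_1 w_0.  A bounded convex sequence on the naturals is
    nonincreasing, which gives |w_0| <= |N_1 w_0|.

    The remaining ingredients are the Riesz representation theorem ([riesz]), which
    makes the adjoint meaningful, and square roots of positive matrices. *)

(** * Adjoints of bounded operators *)

Section Hilbert.
Context {R : realType} {H : hilbertType R}.
Implicit Types (x y z : H) (t : R) (c : R[i]).

Definition rdot x y : R := complex.Re (dotp x y).

Lemma dotpC x y : dotp x y = Num.conj (dotp y x).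
Proof. by rewrite hermC expr0 mul1r. Qed.

Lemma rdotC x y : rdot x y = rdot y x.
Proof. by rewrite /rdot dotpC; case: (dotp y x). Qed.

Lemma rdotDl x y z : rdot (x + y) z = rdot x z + rdot y z.
Proof. by rewrite /rdot linearDl raddfD. Qed.

Lemma rdotZl t x y : rdot (t%:C%C *: x) y = t * rdot x y.
Proof.
by rewrite /rdot linearZl_LR /=; case: (dotp x y) => a b /=; rewrite mul0r subr0.
Qed.

Lemma rdotDr x y z : rdot z (x + y) = rdot z x + rdot z y.
Proof. by rewrite !(rdotC z) rdotDl. Qed.

Lemma rdotZr t x y : rdot y (t%:C%C *: x) = t * rdot y x.
Proof. by rewrite !(rdotC y) rdotZl. Qed.

Lemma rdotNl x y : rdot (- x) y = - rdot x y.
Proof. by rewrite -scaleN1r -(rmorphN1 (real_complex R)) rdotZl mulN1r. Qed.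

Lemma rdotNr x y : rdot y (- x) = - rdot y x.
Proof. by rewrite !(rdotC y) rdotNl. Qed.

Definition rdotE := (rdotDl, rdotDr, rdotNl, rdotNr, rdotZl, rdotZr).

Lemma dotp_rdot x : dotp x x = (rdot x x)%:C%C.
Proof. by rewrite /rdot RRe_real// ger0_real// dnorm_ge0. Qed.

Lemma rdot_ge0 x : 0 <= rdot x x.
Proof. by rewrite -ler0c -dotp_rdot dnorm_ge0. Qed.

Lemma rdot_eq0 x : rdot x x = 0 -> x = 0.
Proof. by move=> x0; apply/eqP; rewrite -(dnorm_eq0 dotp) dotp_rdot x0. Qed.

Lemma norm_le_rdot x t : 0 <= t -> (`|x| <= t%:C%C) = (rdot x x <= t ^+ 2).
Proof.
move=> t0; rewrite -ler_sqr ?nnegrE ?ler0c// sqr_normE -rmorphXn dotp_rdot.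
exact: lecR.
Qed.

Lemma rdot_CauchySchwarz x y : rdot x y ^+ 2 <= rdot x x * rdot y y.
Proof.
have := dot_CauchySchwarz dotp x y.
rewrite !dotp_rdot -rmorphM /= /rdot; case: (dotp x y) => a b /=.
rewrite -(RRe_real (normr_real _)) -rmorphXn lecR normc_def /= => h.
apply: le_trans h; rewrite sqr_sqrtr ?addr_ge0 ?sqr_ge0//.
by rewrite lerDl sqr_ge0.
Qed.

Lemma dotp_ext x y : (forall z, rdot z x = rdot z y) -> x = y.
Proof.
move=> xy; apply/eqP; rewrite -subr_eq0; apply/eqP/rdot_eq0.
by rewrite rdotDr rdotNr xy subrr.
Qed.

Lemma Im_dotp x y : complex.Im (dotp x y) = - rdot ('i%C *: x) y.
Proof. by rewrite /rdot linearZl_LR /=; case: (dotp x y) => a b /=; ring. Qed.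

(** The discriminant of a nonnegative quadratic polynomial, allowing a leading
    coefficient 0. *)
Lemma quadratic_ge0 (a b e : R) :
  (forall t, 0 <= t ^+ 2 * a + 2 * (t * b) + e) -> 0 <= a -> b ^+ 2 <= a * e.
Proof.
move=> h a0; have [a_eq|a_neq] := eqVneq a 0; last first.
  have ap : 0 < a by rewrite lt_def a_neq.
  have := h (- (b / a)).
  rewrite -(pmulr_rge0 _ ap).
  have -> : a * ((- (b / a)) ^+ 2 * a + 2 * (- (b / a) * b) + e) = a * e - b ^+ 2.
    by field.
  by rewrite subr_ge0.
rewrite a_eq mul0r; have [->|b0] := eqVneq b 0; first by rewrite expr0n.
have := h (- ((e + 1) / (2 * b))); rewrite a_eq.
have -> : (- ((e + 1) / (2 * b))) ^+ 2 * 0 + 2 * (- ((e + 1) / (2 * b)) * b) + e = -1.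
  by field.
by rewrite lerNr oppr0 ler10.
Qed.

(** The functional f is represented by the minimizer of
    J(y) = |y|^2 - 2 Re f(y).  By the parallelogram law, two points at which J is
    within e of its infimum m are at distance at most 2 sqrt(e), so the sublevel sets
    of J form a Cauchy filter.  From such a point y, J can decrease by at most e in any
    direction x, so that Re <x, y> and Re f(x) agree up to sqrt(e) |x|. *)
Lemma riesz (f : H -> R[i]) (M : R) : 0 <= M ->
  (forall c x y, f (c *: x + y) = c * f x + f y) ->
  (forall x, complex.Re (f x) ^+ 2 <= M * rdot x x) ->
  exists y, forall x, f x = dotp x y.
Proof.
move=> M0 flin fM; pose r x := complex.Re (f x).
have rlin t x y : r (t%:C%C *: x + y) = t * r x + r y.
  by rewrite /r flin; case: (f x) (f y) => a b [a' b'] /=; ring.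
pose J y := rdot y y - 2 * r y.
have JD t x y : J (y + t%:C%C *: x) =
    J y + t ^+ 2 * rdot x x + 2 * (t * (rdot x y - r x)).
  by rewrite /J (addrC y) rlin !rdotE (rdotC y x); ring.
have JM y : - M <= J y.
  rewrite lerNl /J opprB lerBlDr leNgt; apply/negP => h.
  have y0 := rdot_ge0 y.
  have := fM y; rewrite -/(r y) leNgt => /negP; apply.
  have : (M + rdot y y) ^+ 2 < (2 * r y) ^+ 2 by rewrite ltr_sqr ?nnegrE; lra.
  have := sqr_ge0 (M - rdot y y); rewrite !expr2; lra.
pose m := inf (range J).
have hJ : has_inf (range J).
  by split; [exists (J 0), 0|exists (- M) => _ [y _ <-]].
have mJ y : m <= J y by apply: ge_inf; [case: hJ|exists y].
have exJ e : 0 < e -> exists y, J y < m + e.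
  by move=> /inf_adherent/(_ hJ)[_ [y _ <-] ye]; exists y.
(* J is at least m at the midpoint z + (y - z) / 2. *)
have close e y z : J y < m + e -> J z < m + e -> rdot (y - z) (y - z) < 4 * e.
  move=> ye ze; have := mJ (z + (1 / 2)%:C%C *: (y - z)); rewrite JD.
  have := JD 1 (y - z) z; rewrite rmorph1 scale1r addrC subrK.
  move: (rdot (y - z) z - r (y - z)) => k; lra.
have var e x y : J y < m + e -> (rdot x y - r x) ^+ 2 <= rdot x x * e.
  move=> ye; apply: quadratic_ge0; last exact: rdot_ge0.
  move=> t; have := mJ (y + t%:C%C *: x); rewrite JD; lra.
pose F : set_system H := [set A | exists2 e, 0 < e & forall y, J y < m + e -> A y].
have FF : ProperFilter F.
  split; first by case=> e /exJ[y ye] /(_ _ ye).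
  split.
  - by exists 1.
  - move=> A B [e e0 eA] [e' e0' eB]; exists (Num.min e e').
      by rewrite lt_min e0.
    move=> y ye; split; [apply: eA|apply: eB]; apply: lt_le_trans ye _;
    by rewrite lerD2l ge_min lexx ?orbT.
  - by move=> A B AB [e e0 eA]; exists e => // y /eA/AB.
have Fc : cauchy F.
  apply: cauchy_exP => e e0.
  have [e1 e2] : e = (complex.Re e)%:C%C /\ 0 < complex.Re e.
    by move: e0; rewrite ltcE /=; case: (e) => a b /= /andP[/eqP -> ->].
  have d0 : 0 < (complex.Re e / 4) ^+ 2 by rewrite exprn_gt0// divr_gt0.
  have [y ye] := exJ _ d0; exists y; exists ((complex.Re e / 4) ^+ 2) => // z ze.
  rewrite -ball_normE /= e1; apply: (@le_lt_trans _ _ (complex.Re e / 2)%:C%C).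
    rewrite norm_le_rdot ?divr_ge0 ?ltW//.
    have := close _ _ _ ye ze; lra.
  by rewrite ltcR; lra.
have [y0 Fy0] := (cvg_ex F).1 (cauchy_cvg _ Fc).
exists y0.
suff rE x : r x = rdot x y0.
  move=> x; apply/eqP; rewrite eq_complex -/(r x) -/(rdot x y0) rE eqxx /=.
  apply/eqP; rewrite Im_dotp -rE /r -[_ *: x]addr0 flin.
  have -> : f 0 = 0.
    by have := flin (-1) 0 0; rewrite scaler0 addr0 mulN1r addNr.
  by case: (f x) => a b /=; ring.
apply/eqP; rewrite eq_sym -subr_eq0 -(sqrf_eq0 (_ - _)) eq_le sqr_ge0 andbT.
apply/ler_addgt0Pr => e e0; rewrite add0r.
have x0 := rdot_ge0 x.
(* The error is a sum of two terms, each of square at most d |x|^2, whence the factor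
   4; the summand 1 keeps the denominator positive when x = 0. *)
have d0 : 0 < e / (4 * (rdot x x + 1)) by rewrite divr_gt0//; lra.
set d := e / _ in d0.
have s0 : 0 < Num.sqrt d by rewrite sqrtr_gt0.
have [e' e0' eB] : F (ball y0 (Num.sqrt d)%:C%C).
  by apply: Fy0; apply: nbhsx_ballx; rewrite ltcR.
have [y ye] : exists y, J y < m + Num.min d e'.
  by apply: exJ; rewrite lt_min d0.
have /eB : J y < m + e' by apply: lt_le_trans ye _; rewrite lerD2l ge_min lexx orbT.
rewrite -ball_normE /= => /ltW; rewrite (norm_le_rdot _ (ltW s0)) (sqr_sqrtr (ltW d0)) => yd.
have /(var _ x) yx : J y < m + d by apply: lt_le_trans ye _; rewrite lerD2l ge_min lexx.
have := rdot_CauchySchwarz x (y0 - y).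
have : rdot x x * rdot (y0 - y) (y0 - y) <= rdot x x * d by rewrite ler_wpM2l.
have -> : rdot x y0 - r x = rdot x (y0 - y) + (rdot x y - r x).
  by rewrite rdotDr rdotNr; ring.
have dE : 4 * (rdot x x * d) + 4 * d = e.
  by rewrite /d; field; rewrite gt_eqF//; lra.
move: yx; move: (rdot x y - r x) (rdot x (y0 - y)) => a b ha hc hb.
have := sqr_ge0 (a - b); lra.
Qed.

Lemma bounded_opP (T : H -> H) : bounded_op T ->
  exists2 M, 0 <= M & forall x, rdot (T x) (T x) <= M * rdot x x.
Proof.
move=> [_ [M TM]]; exists (M ^+ 2) => [|x]; first exact: sqr_ge0.
have := TM x; rewrite -ler_sqr ?nnegrE ?(le_trans (normr_ge0 _) (TM x))//.
by rewrite exprMn !sqr_normE !dotp_rdot -rmorphXn -rmorphM lecR.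
Qed.

(** The operator chosen by [adj] is a genuine adjoint: for fixed y the functional
    x |-> <T x, y> is bounded, so one exists. *)
Lemma adjP (T : H -> H) : bounded_op T -> forall x y, dotp (T x) y = dotp x (adj T y).
Proof.
move=> Tb; have [M M0 TM] := bounded_opP Tb; case: Tb => Tlin _.
suff [S hS] : exists S, forall x y, dotp (T x) y = dotp x (S y).
  by rewrite /adj; case: xgetP => [_ -> //|/(_ S)].
have /choice[S hS] : forall y, exists z, forall x, dotp (T x) y = dotp x z.
  move=> y; apply: (@riesz _ (M * rdot y y)) => [|c u v|u].
    by rewrite mulr_ge0 ?rdot_ge0.
    by rewrite Tlin linearDl linearZl_LR.
  rewrite -/(rdot (T u) y); apply: le_trans (rdot_CauchySchwarz _ _) _.
  by rewrite mulrAC ler_wpM2r ?rdot_ge0.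
by exists S => x y; exact: hS.
Qed.

Lemma adj_rdot (T : H -> H) : bounded_op T -> forall x y, rdot (T x) y = rdot x (adj T y).
Proof. by move=> Tb x y; rewrite /rdot adjP. Qed.

Lemma bounded_op_comp (T S : H -> H) :
  bounded_op T -> bounded_op S -> bounded_op (T \o S).
Proof.
move=> [Tl [M TM]] [Sl [M' SM]]; split.
  by move=> c x y /=; rewrite Sl Tl.
have M0 (K : R) (F : H -> H) : (forall x, `|F x| <= K%:C%C * `|x|) ->
    (forall x, `|F x| <= `|K|%:C%C * `|x|).
  move=> FK x; apply: le_trans (FK x) _; rewrite ler_wpM2r//.
  by rewrite lecR ler_norm.
exists (`|M| * M') => x /=; apply: (le_trans (M0 _ _ TM _)).
by rewrite rmorphM /= -mulrA ler_wpM2l// ler0c.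
Qed.

End Hilbert.

(** * Normal operators and orbits of constant norm *)

(** The increments of a convex sequence are nondecreasing: if the first one were
    positive, the sequence would grow at least linearly. *)
Lemma bounded_convex_nonincreasing (R : realType) (u : nat -> R) (M : R) :
  (forall k, 2 * u k.+1 <= u k + u k.+2) -> (forall k, u k <= M) -> u 1%N <= u 0%N.
Proof.
move=> uc uM; rewrite leNgt; apply/negP; rewrite -subr_gt0; set d := _ - _ => d0.
have ud k : d <= u k.+1 - u k by elim: k => [|k IH]; [|have := uc k; lra].
have uk k : u 0%N + d *+ k <= u k.
  by elim: k => [|k IH]; [rewrite addr0|have := ud k; rewrite mulrS; lra].
have := archi_boundP (normr_ge0 ((M - u 0%N) / d)); set k := Num.bound _ => hk.
have := le_lt_trans (ler_norm _) hk.
rewrite ltr_pdivrMr// mulr_natl; have := uk k; have := uM k; lra.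
Qed.

Section NormalOperator.
Context {R : realType} {H : hilbertType R}.
Variables (N M : H -> H).
Hypotheses (Nn : normal_op N) (Mb : bounded_op M) (NM : N \o M = M \o N).

Let NA x : adj N (N x) = N (adj N x).
Proof. by case: Nn => _ /(congr1 (@^~ x)). Qed.

Lemma normal_rdot x : rdot (adj N x) (adj N x) = rdot (N x) (N x).
Proof.
by rewrite -(adj_rdot Nn.1) -NA rdotC -(adj_rdot Nn.1).
Qed.

(** The nonnegativity of the left-hand side makes |x|^2, |N x|^2, |N^2 x|^2 a convex
    triple; if N preserves the norms of x and N x, it gives N^* N x = x. *)
Lemma normal_defect x : rdot (adj N (N x) - x) (adj N (N x) - x) =
  rdot (N (N x)) (N (N x)) - 2 * rdot (N x) (N x) + rdot x x.
Proof.
have := normal_rdot (N x); rewrite !rdotE => ->.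
by rewrite [rdot x _ in X in _ + X]rdotC (rdotC _ x) -(adj_rdot Nn.1); ring.
Qed.

(** Iterating N^* continues the orbit of x backwards with constant norm, and M maps it
    to a bounded backward orbit of M x under N, along which squared norms are convex. *)
Lemma normal_norm_le x :
  rdot (N x) (N x) = rdot x x -> rdot (N (N x)) (N (N x)) = rdot x x ->
  rdot (M x) (M x) <= rdot (N (M x)) (N (M x)).
Proof.
move=> x1 x2; pose y k := iter k (adj N) x.
have yE k : adj N (N (y k)) = y k.
  elim: k => [|k IH]; last by rewrite /= -/(y k) -NA IH.
  by apply/eqP; rewrite -subr_eq0; apply/eqP/rdot_eq0; rewrite normal_defect x1 x2; ring.
have yS k : N (y k.+1) = y k by rewrite /= -/(y k) -NA yE.
have yy k : rdot (y k) (y k) = rdot x x.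
  by elim: k => // k IH; rewrite -[LHS]/(rdot (adj N _) _) normal_rdot (adj_rdot Nn.1) yE.
have MS k : N (M (y k.+1)) = M (y k).
  by rewrite -[LHS]/((N \o M) _) NM /= -/(y k.+1) yS.
have [C C0 MC] := bounded_opP Mb.
(* The sequence is indexed backwards and starts one step forward, at N (M x). *)
pose u k := if k is k'.+1 then rdot (M (y k')) (M (y k')) else rdot (N (M x)) (N (M x)).
apply: (@bounded_convex_nonincreasing R u
  (C * rdot x x + rdot (N (M x)) (N (M x)))) => k; last first.
  case: k => [|k] /=; first by rewrite lerDr mulr_ge0 ?rdot_ge0.
  by apply: (le_trans (MC _)); rewrite yy lerDl rdot_ge0.
have := rdot_ge0 (adj N (N (M (y k.+1))) - M (y k.+1)); rewrite normal_defect !MS.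
by case: k => [|k] /=; rewrite ?(MS k); lra.
Qed.

End NormalOperator.

(** * Positive matrices *)

Section Matrices.
Context {R : realType} {d : nat}.
Implicit Types (u v w h : 'cV[R[i]]_d) (M N S : 'M[R[i]]_d) (c : R[i]).

Definition ctrmx M : 'M[R[i]]_d := map_mx Num.conj M^T.

Lemma cdot_ctr M v w : cdot (M *m v) w = cdot v (ctrmx M *m w).
Proof.
rewrite /cdot; under eq_bigr => k _ do rewrite mxE mulr_suml.
rewrite exchange_big /=; apply: eq_bigr => k _.
rewrite mxE rmorph_sum mulr_sumr; apply: eq_bigr => l _.
by rewrite rmorphM !mxE /= conjCK mulrA [v k 0 * _]mulrC.
Qed.

Lemma cdot_0l w : cdot 0 w = 0.
Proof. by rewrite /cdot big1// => k _; rewrite mxE mul0r. Qed.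

Lemma cdot_subl u v w : cdot (u - v) w = cdot u w - cdot v w.
Proof. by rewrite addrC -scaleN1r cdotDl mulN1r addrC. Qed.

Lemma cdot_addr u v w : cdot u (v + w) = cdot u v + cdot u w.
Proof. by rewrite !(cdotC u) -[in LHS](scale1r v) cdotDl mul1r rmorphD. Qed.

Lemma cdot_addl u v w : cdot (u + v) w = cdot u w + cdot v w.
Proof. by rewrite -{1}[u]scale1r cdotDl mul1r. Qed.

Lemma cdot_scalel c v w : cdot (c *: v) w = c * cdot v w.
Proof. by rewrite -[c *: v]addr0 cdotDl cdot_0l addr0. Qed.

Lemma cdot_scaler c v w : cdot v (c *: w) = Num.conj c * cdot v w.
Proof. by rewrite !(cdotC v) cdot_scalel rmorphM. Qed.

Lemma cdot_inj v w : (forall h, cdot v h = cdot w h) -> v = w.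
Proof.
move=> vw; apply/eqP; rewrite -subr_eq0; apply/eqP/sqnorm_eq0.
by rewrite /sqnorm cdot_subl vw subrr.
Qed.

Lemma ctrmxM M N : ctrmx (M *m N) = ctrmx N *m ctrmx M.
Proof. by rewrite /ctrmx trmx_mul map_mxM. Qed.

Lemma ctrmxV M : ctrmx (invmx M) = invmx (ctrmx M).
Proof. by rewrite /ctrmx trmx_inv map_invmx. Qed.

(** Polarization: replacing w by i w in the sum of the two cross terms changes it into
    a multiple of their difference, so both vanish. *)
Lemma form_eq0 M : (forall v, cdot (M *m v) v = 0) -> M = 0.
Proof.
move=> M0.
have anti v w : cdot (M *m v) w + cdot (M *m w) v = 0.
  by have := M0 (v + w); rewrite mulmxDr cdot_addr !cdot_addl !M0 add0r addr0 addrC.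
have M0' v w : cdot (M *m v) w = 0.
  have := anti v ('i *: w); rewrite -scalemxAr cdot_scalel cdot_scaler conjCi mulNr addrC.
  move/eqP; rewrite subr_eq0 => /eqP/(mulfI (neq0Ci _)) e.
  by have := anti v w; rewrite e -mulr2n => /eqP; rewrite mulrn_eq0 => /eqP.
apply/matrixP => i j; have := M0' (delta_mx j 0) (delta_mx i 0).
rewrite /cdot (bigD1 i)//= big1 => [|k /negPf ki]; last first.
  by rewrite !mxE ki /= conjC0 mulr0.
by rewrite -colE !mxE !eqxx /= conjC1 mulr1 addr0.
Qed.

(** A positive quadratic form is in particular real, and then M - M^* has zero
    quadratic form. *)
Lemma posmx_herm M : posmx M -> ctrmx M = M.
Proof.
move=> Mp; apply/eqP; rewrite -subr_eq0; apply/eqP/form_eq0 => v.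
rewrite mulmxBl cdot_subl [cdot (ctrmx M *m v) v]cdotC -cdot_ctr.
by rewrite (conj_Creal (ger0_real (Mp v))) subrr.
Qed.

(** The vector w = S v - l v satisfies S w = - l w, which positivity only permits for
    w = 0.  This determines a positive square root of a matrix on the eigenvectors of
    that matrix. *)
Lemma posmx_eigen S v (l : R) : posmx S -> 0 < l ->
  S *m (S *m v) = (l ^+ 2)%:C%C *: v -> S *m v = l%:C%C *: v.
Proof.
move=> Sp l0 SSv; apply/eqP; rewrite -subr_eq0; apply/eqP; set w := _ - _.
have Sw : S *m w = (- l%:C%C) *: w.
  rewrite /w mulmxBr SSv -scalemxAr scalerBr scalerA scaleNr mulNr scaleNr opprK addrC.
  by rewrite -rmorphM -expr2.
have := Sp w; rewrite Sw cdot_scalel cdotvv mulNr -rmorphM oppr_ge0 => h.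
apply: sqnorm_eq0; apply/eqP; rewrite eq_le sqnorm_ge0 andbT.
by rewrite -(pmulr_rle0 _ l0) -lecR.
Qed.

Lemma mulmx_ext M S : (forall v, M *m v = S *m v) -> M = S.
Proof.
move=> MS; apply/matrixP => i j.
by have := congr1 (fun v : 'cV_d => v i 0) (MS (delta_mx j 0)); rewrite -!colE !mxE.
Qed.

(** For a matrix of order 2 with trace tr and determinant e^2 the last hypothesis is
    the Cayley-Hamilton identity.  It gives (M + e)^2 = (tr + 2 e) M, so that
    (M + e) / sqrt (tr + 2 e) is a square root of M. *)
Lemma sqrtmx_exists M (tr e : R) : posmx M -> 0 <= e -> 0 < tr + 2 * e ->
  M *m M = tr%:C%C *: M - ((e ^+ 2)%:C%C)%:M -> exists S, posmx S /\ S *m S = M.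
Proof.
move=> Mp e0 t0 MM; pose t := Num.sqrt (tr + 2 * e).
have tt : t ^+ 2 = tr + 2 * e by rewrite sqr_sqrtr ?ltW.
have tp : 0 < t by rewrite sqrtr_gt0.
exists ((t^-1)%:C%C *: (M + (e%:C%C)%:M)); split.
  move=> v; rewrite -scalemxAl cdot_scalel mulr_ge0 ?ler0c ?invr_ge0 ?(ltW tp)//.
  rewrite mulmxDl mul_scalar_mx cdot_addl addr_ge0//.
  by rewrite cdot_scalel mulr_ge0 ?ler0c// cdotvv ler0c sqnorm_ge0.
rewrite -scalemxAl -scalemxAr scalerA mulmxDl !mulmxDr MM mul_mx_scalar.
rewrite mul_scalar_mx -scalar_mxM -!rmorphM -!expr2.
have -> : tr%:C%C *: M - ((e ^+ 2)%:C%C)%:M + e%:C%C *: M +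
    (e%:C%C *: M + ((e ^+ 2)%:C%C)%:M) = (t ^+ 2)%:C%C *: M.
  rewrite tt mulr_natl mulr2n !rmorphD !scalerDl.
  by rewrite -!addrA; congr (_ + _); rewrite addrC -!addrA subrr addr0.
by rewrite scalerA -rmorphM exprVn mulVf ?scale1r// expf_neq0// gt_eqF.
Qed.

Lemma sqrtmxP M : (exists S, posmx S /\ S *m S = M) ->
  posmx (sqrtmx M) /\ sqrtmx M *m sqrtmx M = M.
Proof. by move=> [S SM]; rewrite /sqrtmx; case: xgetP => [_ -> //|/(_ S)]. Qed.

End Matrices.

(** * Operators on square-summable families *)

Section L2.
Context {R : realType} {I : choiceType} {d : nat}.
#[local] Existing Instance totally_filter.
Notation l2 := (l2 R I d).
Implicit Types (f g : l2) (p q : I) (h k : 'cV[R[i]]_d) (T S : l2 -> l2).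

(** Pairing with the vectors supported at one point recovers all coordinates; this is
    how operators on square-summable families are evaluated below. *)
Lemma dotp_single f p h : dotp f (l2_single p h) = cdot (f p) h.
Proof.
apply: l2_dotE; apply: cvg_near_cst; exists [fset p]%fset => // A /= pA.
rewrite partial_sumE (big_fsetD1 p) /=; last by apply: (fsubsetP pA); rewrite inE.
rewrite eqxx big_seq big1 ?addr0// => i; rewrite !inE => /andP[/negPf -> _].
by rewrite cdotC cdot_0l rmorph0.
Qed.

Lemma l2_ext f g : (forall p, f p = g p) -> f = g.
Proof. by move=> fg; apply/val_inj/funext. Qed.

Lemma rdot_single p h : rdot (l2_single p h) (l2_single p h) = sqnorm h.
Proof. by rewrite /rdot dotp_single /= eqxx. Qed.

(** The adjoint of T is determined coordinatewise by the values of T on vectors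
    supported at one point; passing to adjoints replaces a density argument. *)
Lemma bounded_op_ext T S : bounded_op T -> bounded_op S ->
  (forall p h, T (l2_single p h) = S (l2_single p h)) -> T = S.
Proof.
move=> Tb Sb TS; apply/funext => f; apply: dotp_ext => g.
rewrite rdotC (rdotC g) (adj_rdot Tb) (adj_rdot Sb); congr rdot.
apply: l2_ext => p; apply: cdot_inj => h.
by rewrite -!(dotp_single (adj _ _)) ![dotp (adj _ _) _]dotpC -!adjP// TS.
Qed.

(** Operators moving coordinates along a partial injection: coordinate i of the image
    is U i applied to coordinate s i, or 0 if s i is undefined.  Forward shifts and
    diagonal operators are both of this form. *)
Section Lift.
Variables (s : I -> option I) (U : I -> 'M[R[i]]_d) (c : R).
Hypothesis s_inj : forall i j (k : I), s i = Some k -> s j = Some k -> i = j.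
Hypothesis Uc : forall i v, sqnorm (U i *m v) <= c ^+ 2 * sqnorm v.

Definition lift_fun (f : I -> 'cV[R[i]]_d) i :=
  if s i is Some j then U i *m f j else 0.

(** Since s is injective where it is defined, the terms of the image over a finite set
    are dominated by the terms of f over a finite set of the same or smaller size. *)
Lemma sum_lift_le f (M : R) :
  (forall A, partial_sum (fun i => sqnorm (f i)) A <= M) ->
  forall A, partial_sum (fun i => sqnorm (lift_fun f i)) A <= c ^+ 2 * M.
Proof.
move=> fM A.
apply: (@le_trans _ _ (\sum_(i <- A) c ^+ 2 * oapp (fun j => sqnorm (f j)) 0 (s i))).
  rewrite partial_sumE; apply: ler_sum => i _; rewrite /lift_fun.
  by case: (s i) => [j|] /=; rewrite ?Uc// sqnorm0 mulr0.
rewrite -mulr_sumr ler_wpM2l ?sqr_ge0// -big_pmap.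
apply: le_trans (fM [fset j in pmap s A]%fset); rewrite partial_sumE.
rewrite le_eqVlt; apply/orP; left; apply/eqP/perm_big.
apply: uniq_perm; rewrite ?fset_uniq//; last by move=> j; rewrite !inE.
elim: (enum_fset A) (fset_uniq A) => //= i r IH /andP[ir /IH{}IH].
case E : (s i) => [j|] //=; rewrite IH andbT mem_pmap.
by apply: contra ir => /mapP[k kr /esym/(s_inj E)->].
Qed.

Lemma lift_subproof f : lift_fun f \in @l2_pred R I d.
Proof.
have [M fM] := l2funP f; apply/l2P; exists (c ^+ 2 * M) => A.
exact: sum_lift_le.
Qed.

Definition lift_op f : l2 := L2 (lift_subproof f).

Lemma lift_op_bounded : bounded_op lift_op.
Proof.
split=> [a f g|].
  apply: l2_ext => i; rewrite -[RHS]/(a *: lift_fun f i + lift_fun g i) /=.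
  rewrite /lift_fun; case: (s i) => [j|].
    by rewrite mulmxDr -scalemxAr.
  by rewrite scaler0 addr0.
exists `|c| => f.
have nf : `|f| = (complex.Re `|f|)%:C%C by rewrite RRe_real// normr_real.
have f0 : 0 <= complex.Re `|f| by rewrite -ler0c -nf.
rewrite nf -rmorphM; apply: l2_norm_le; first exact: mulr_ge0.
move=> A; rewrite exprMn real_normK ?num_real//.
by apply: sum_lift_le => B; apply: l2_norm_ge; rewrite -nf.
Qed.

End Lift.

Section Shift.
Variables (s : I -> I) (W : I -> 'M[R[i]]_d) (T : l2 -> l2).
Hypothesis s_inj : injective s.
Hypothesis Tb : bounded_op T.
Hypothesis TE : forall p h, T (l2_single p h) = l2_single (s p) (W p *m h).

Lemma adj_shift f p : adj T f p = ctrmx (W p) *m f (s p).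
Proof.
apply: cdot_inj => h; rewrite -dotp_single dotpC -adjP// TE -dotpC dotp_single.
by rewrite cdotC cdot_ctr -cdotC.
Qed.

Lemma adj_shift_single p h : adj T (l2_single (s p) h) = l2_single p (ctrmx (W p) *m h).
Proof.
apply: l2_ext => q; rewrite adj_shift /= (inj_eq s_inj).
by case: eqP => [->//|_]; rewrite mulmx0.
Qed.

Lemma shift_coord f p : T f (s p) = W p *m f p.
Proof.
apply: cdot_inj => h.
by rewrite -dotp_single adjP// adj_shift_single dotp_single cdot_ctr.
Qed.

Lemma gram_shift_single p h :
  adj T (T (l2_single p h)) = l2_single p (ctrmx (W p) *m (W p *m h)).
Proof. by rewrite TE adj_shift_single. Qed.

Variables (G : I -> 'M[R[i]]_d).
Hypothesis GW : forall p, G p *m (ctrmx (W p) *m W p) = 1%:M.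
Hypothesis G1 : forall p v, sqnorm (G p *m v) <= sqnorm v.

(** T^* T acts diagonally through the matrices W^* W, so the uniformly bounded
    diagonal operator with entries G inverts it. *)
Lemma inv_gram_shift p h : inv_op (adj T \o T) (l2_single p h) = l2_single p (G p *m h).
Proof.
have WG q : (ctrmx (W q) *m W q) *m G q = 1%:M by exact: mulmx1C.
have gT f q : (adj T \o T) f q = (ctrmx (W q) *m W q) *m f q.
  by rewrite /= adj_shift shift_coord mulmxA.
suff [S [Sb S1 S2]] : exists S, [/\ bounded_op S, cancel (adj T \o T) S
    & cancel S (adj T \o T)].
  rewrite /inv_op; case: xgetP => [S' _ /= [_ S'1 _]|/(_ S)[]//].
  rewrite -[RHS]S'1 /=; congr S'; rewrite gram_shift_single.
  by congr l2_single; rewrite [RHS]mulmxA mulmxA WG mul1mx.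
have G1' i v : sqnorm (G i *m v) <= 1 ^+ 2 * sqnorm v by rewrite expr1n mul1r.
have sI (i j k : I) : Some i = Some k -> Some j = Some k -> i = j.
  by move=> [->] [->].
exists (lift_op sI G1'); split; first exact: lift_op_bounded.
- move=> f; apply: l2_ext => q; rewrite /= /lift_fun.
  by rewrite -[adj T _]/((adj T \o T) f) gT mulmxA GW mul1mx.
- by move=> f; apply: l2_ext => q; rewrite gT /= /lift_fun mulmxA WG mul1mx.
Qed.

Lemma cauchy_dual_single p h :
  (T \o inv_op (adj T \o T)) (l2_single p h) = l2_single (s p) (W p *m G p *m h).
Proof. by rewrite /= inv_gram_shift TE mulmxA. Qed.

End Shift.
End L2.

(** * Block shifts on the quadrant lattice *)

Definition step (j : 'I_2) (p : nat * nat) : nat * nat :=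
  if j == 0 then (p.1.+1, p.2) else (p.1, p.2.+1).

Lemma step_inj j : injective (step j).
Proof. by move=> [a b] [c d]; rewrite /step; case: ifP => _ [-> ->]. Qed.

Lemma stepC i j p : step i (step j p) = step j (step i p).
Proof. by rewrite /step; case: ifP; case: ifP. Qed.

Definition unstep (j : 'I_2) (p : nat * nat) : option (nat * nat) :=
  if j == 0 then (if p.1 is m.+1 then Some (m, p.2) else None)
  else (if p.2 is n.+1 then Some (p.1, n) else None).

Lemma unstepP j p q : unstep j p = Some q <-> p = step j q.
Proof.
rewrite /unstep /step; case: ifP => _; case: p q => [a b] [c e] /=.
  by split; [case: a => // a [-> ->]|move=> [-> ->]].
by split; [case: b => // b [-> ->]|move=> [-> ->]].
Qed.

(** D stands for the moment matrices of the shift and Q for Hermitian square roots of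
    them. *)
Section Weights.
Context {R : realType} {d : nat}.
Notation l2 := (l2 R (nat * nat)%type d).
Variables (D Q : nat * nat -> 'M[R[i]]_d).
Hypothesis Q_herm : forall p, ctrmx (Q p) = Q p.
Hypothesis QQ : forall p, Q p *m Q p = D p.
Hypothesis Q_unit : forall p, Q p \in unitmx.
Hypothesis D_affine : forall i j p,
  D p - D (step i p) - D (step j p) + D (step i (step j p)) = 0.
Variable c : R.
Hypothesis c_ge1 : 1 <= c.
Hypothesis D_le : forall j p v,
  complex.Re (cdot (D (step j p) *m v) v) <= c ^+ 2 * complex.Re (cdot (D p *m v) v).
Hypothesis D_ge : forall j p v,
  complex.Re (cdot (D p *m v) v) <= complex.Re (cdot (D (step j p) *m v) v).

Definition weight j p := Q (step j p) *m invmx (Q p).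

Lemma sqnorm_Q p v : sqnorm (Q p *m v) = complex.Re (cdot (D p *m v) v).
Proof. by rewrite /sqnorm -QQ -mulmxA [in RHS]cdot_ctr Q_herm. Qed.

(** The telescoping that makes the shift commute and reduces products of weights to
    the endpoints of a lattice path. *)
Lemma weight_comp i j p :
  weight i (step j p) *m weight j p = Q (step i (step j p)) *m invmx (Q p).
Proof. by rewrite /weight mulmxA mulmxKV. Qed.

Lemma ctr_QV p q : ctrmx (Q p *m invmx (Q q)) = invmx (Q q) *m Q p.
Proof. by rewrite ctrmxM ctrmxV !Q_herm. Qed.

Lemma gram_QV p q (v : 'cV[R[i]]_d) :
  ctrmx (Q p *m invmx (Q q)) *m (Q p *m invmx (Q q) *m v) =
  invmx (Q q) *m D p *m invmx (Q q) *m v.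
Proof. by rewrite ctr_QV -QQ !mulmxA. Qed.

Lemma gram_weight j p (v : 'cV[R[i]]_d) :
  ctrmx (weight j p) *m (weight j p *m v) =
  invmx (Q p) *m D (step j p) *m invmx (Q p) *m v.
Proof. exact: gram_QV. Qed.

Lemma gram_weight2 i j p (v : 'cV[R[i]]_d) :
  ctrmx (weight j p) *m (ctrmx (weight i (step j p)) *m
    (weight i (step j p) *m (weight j p *m v))) =
  invmx (Q p) *m D (step i (step j p)) *m invmx (Q p) *m v.
Proof.
rewrite (mulmxA (weight i (step j p))) (mulmxA (ctrmx (weight j p))).
by rewrite -ctrmxM weight_comp gram_QV.
Qed.

Lemma sqnorm_weight j p v : sqnorm (weight j p *m v) <= c ^+ 2 * sqnorm v.
Proof.
rewrite /weight -mulmxA sqnorm_Q; apply: le_trans (D_le _ _ _) _.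
by rewrite -sqnorm_Q mulKVmx.
Qed.

Lemma weight_expands j p v : sqnorm v <= sqnorm (weight j p *m v).
Proof.
rewrite /weight -mulmxA sqnorm_Q; apply: le_trans (D_ge _ _ _).
by rewrite -sqnorm_Q mulKVmx.
Qed.

(** The inverse of W^* W for the weight W = Q' Q^-1, that is, Q D'^-1 Q with
    D' = Q'^2. *)
Definition gramV j p := Q p *m invmx (Q (step j p)) *m (invmx (Q (step j p)) *m Q p).

Lemma gramV_gram j p : gramV j p *m (ctrmx (weight j p) *m weight j p) = 1%:M.
Proof.
apply: mulmx1C; rewrite ctr_QV /gramV /weight !mulmxA mulmxKV// mulmxK//.
by rewrite mulmxK// mulVmx.
Qed.

(** With v = W^* W u, the bound |u|^2 <= |W u|^2 = Re <u, v> and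
    2 Re <u, v> <= |u|^2 + |v|^2 give |u| <= |v|. *)
Lemma sqnorm_gramV j p v : sqnorm (gramV j p *m v) <= sqnorm v.
Proof.
set u := gramV j p *m v.
have vE : (ctrmx (weight j p) *m weight j p) *m u = v.
  by rewrite /u mulmxA (mulmx1C (gramV_gram j p)) mul1mx.
have := weight_expands j p u.
have -> : sqnorm (weight j p *m u) = complex.Re (cdot u v).
  by rewrite /sqnorm cdot_ctr mulmxA vE.
have := sqnorm_ge0 (v - u); rewrite /sqnorm cdot_subl !(cdotC _ (v - u)) !cdot_subl.
rewrite (cdotC v u); case: (cdot v v) (cdot u u) (cdot u v) => a b [a' b'] [e f] /=; lra.
Qed.

Lemma weight_gramV j p : weight j p *m gramV j p = invmx (Q (step j p)) *m Q p.
Proof. by rewrite /weight /gramV !mulmxA mulmxKV// mulmxV// mul1mx. Qed.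

Definition block_shift (T : 'I_2 -> l2 -> l2) :=
  forall j p h, T j (l2_single p h) = l2_single (step j p) (weight j p *m h).

Lemma exists_block_shift : exists T, (forall j, bounded_op (T j)) /\ block_shift T.
Proof.
have inj j p q (r : nat * nat) : unstep j p = Some r -> unstep j q = Some r -> p = q.
  by move=> /unstepP-> /unstepP->.
(* At points without predecessor the default makes the weight the identity, which
   satisfies the bound because c is at least 1. *)
have bd j p v :
    sqnorm (Q p *m invmx (Q (odflt p (unstep j p))) *m v) <= c ^+ 2 * sqnorm v.
  case E : (unstep j p) => [q|] /=; first by move/unstepP: E => ->; exact: sqnorm_weight.
  by rewrite mulmxV// mul1mx ler_peMl ?sqnorm_ge0// expr_ge1// (le_trans ler01).
exists (fun j => lift_op (inj j) (bd j)); split=> [j|j p h].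
  exact: lift_op_bounded.
apply: l2_ext => q; rewrite /= /lift_fun.
case E : (unstep j q) => [r|] /=.
  move/unstepP: E => ->; rewrite (inj_eq (@step_inj j)).
  by case: eqP => [->//|_]; rewrite mulmx0.
by case: eqP => // qE; have /unstepP := qE; rewrite E.
Qed.

Variable T : 'I_2 -> l2 -> l2.
Hypothesis Tb : forall j, bounded_op (T j).
Hypothesis TE : block_shift T.

(** At p the defect operator is Q(p)^-1 (D(p) - D(p+i) - D(p+j) + D(p+i+j)) Q(p)^-1,
    and the second difference of D is 0. *)
Lemma block_shift_toral : toral_2isometry T.
Proof.
split; first split=> //.
  apply: bounded_op_ext; try exact: bounded_op_comp.
  move=> p h; rewrite /= !TE ![weight _ _ *m (weight _ _ *m h)]mulmxA.
  by rewrite !weight_comp stepC.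
move=> i j x; apply: l2_ext => p.
have aE k := adj_shift (Tb k) (TE k).
have tE k := shift_coord (@step_inj k) (Tb k) (TE k).
rewrite -[LHS]/(x p - adj (T i) (T i x) p - adj (T j) (T j x) p
  + adj (T j) (adj (T i) (T i (T j x))) p) !aE !tE gram_weight2 !gram_weight.
have {1}-> : x p = invmx (Q p) *m D p *m invmx (Q p) *m x p.
  by rewrite -QQ mulKmx// mulmxV// mul1mx.
transitivity (invmx (Q p) *m (D p - D (step i p) - D (step j p) + D (step i (step j p)))
    *m invmx (Q p) *m x p); last by rewrite D_affine mulmx0 !mul0mx.
move: (invmx (Q p)) (D p) (D (step i p)) (D (step j p)) (D (step i (step j p))) (x p).
by move=> P M1 M2 M3 M4 v; rewrite (mulmxDr P) !(mulmxBr P) !(mulmxDl, mulNmx).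
Qed.

Lemma cauchy_dual_block j p h : cauchy_dual T j (l2_single p h) =
  l2_single (step j p) (invmx (Q (step j p)) *m (Q p *m h)).
Proof.
rewrite /cauchy_dual (cauchy_dual_single (@step_inj j) (Tb j) (TE j) (gramV_gram j)).
  by rewrite weight_gramV mulmxA.
exact: sqnorm_gramV.
Qed.

(** The generator 0 of the Cauchy dual moves h along the first axis with constant
    norm, while it shortens the image of h under the generator 1. *)
Lemma cauchy_dual_not_subnormal h : (forall n, Q (n, 0%N) *m h = h) ->
  sqnorm (invmx (Q (1%N, 1%N)) *m h) < sqnorm (invmx (Q (0%N, 1%N)) *m h) ->
  ~ jointly_subnormal (cauchy_dual T).
Proof.
move=> Qh lt11 [K [V [N [[Vlin Viso] Nn [Nb NC] NV]]]].
pose S := cauchy_dual T; pose x := l2_single (0%N, 0%N) h : l2.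
have QVh n : invmx (Q (n, 0%N)) *m h = h by rewrite -{1}(Qh n) mulKmx.
have S1 n : S 0 (l2_single (n, 0%N) h) = l2_single (n.+1, 0%N) h.
  by rewrite /S cauchy_dual_block /step /= Qh QVh.
have S2 : S 1 x = l2_single (0%N, 1%N) (invmx (Q (0%N, 1%N)) *m h).
  by rewrite /S cauchy_dual_block /step /= Qh.
have S12 : S 0 (S 1 x) = l2_single (1%N, 1%N) (invmx (Q (1%N, 1%N)) *m h).
  by rewrite S2 /S cauchy_dual_block /step /= mulKVmx.
have VV y : rdot (V y) (V y) = rdot y y by rewrite /rdot Viso.
have := @normal_norm_le _ _ (N 0) (N 1) (Nn 0) (Nb 1) NC (V x).
rewrite !NV -/S !VV S12 S2 !rdot_single !S1 !rdot_single => /(_ erefl erefl).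
by rewrite leNgt lt11.
Qed.

End Weights.

(** * The moment matrices of the example *)

Section Matrix2.
Context {R : realType}.
Implicit Types a b c e x y : R[i].

Definition cv2 x y : 'cV[R[i]]_2 := \col_i nth 0 [:: x; y] i.

Lemma ord2P (P : 'I_2 -> Prop) : P 0 -> P 1 -> forall i, P i.
Proof.
move=> P0 P1 i; have [->|->//] : i = 0 \/ i = 1; last by [].
by case: i => [[|[|//]] ?]; [left|right]; apply/val_inj.
Qed.

Lemma cv2_eta (v : 'cV[R[i]]_2) : v = cv2 (v 0 0) (v 1 0).
Proof. by apply/matrixP; elim/ord2P => j; rewrite ord1 mxE. Qed.

Lemma mx22_cv2 a b c e x y :
  mx22 a b c e *m cv2 x y = cv2 (a * x + b * y) (c * x + e * y).
Proof.
by apply/matrixP; elim/ord2P => j; rewrite !mxE !big_ord_recl big_ord0 !mxE /= addr0.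
Qed.

Lemma scale_cv2 a x y : a *: cv2 x y = cv2 (a * x) (a * y).
Proof. by apply/matrixP; elim/ord2P => j; rewrite !mxE. Qed.

Lemma cdot2 (v w : 'cV[R[i]]_2) :
  cdot v w = v 0 0 * Num.conj (w 0 0) + v 1 0 * Num.conj (w 1 0).
Proof.
rewrite /cdot !big_ord_recl big_ord0 addr0.
by congr (_ + v _ _ * Num.conj (w _ _)); apply/val_inj.
Qed.

Lemma mulmx22 a b c e a' b' c' e' : mx22 a b c e *m mx22 a' b' c' e' =
  mx22 (a * a' + b * c') (a * b' + b * e') (c * a' + e * c') (c * b' + e * e').
Proof.
by apply/matrixP; elim/ord2P; elim/ord2P; rewrite !mxE !big_ord_recl big_ord0 !mxE /= addr0.
Qed.

End Matrix2.

Section Example.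
Context {R : realType}.

Definition initial1 : 'M[R[i]]_2 := mx22 1 0 0 2.
Definition initial2 : 'M[R[i]]_2 := mx22 2 1 1 2.
Definition defect1 := initial1 ^+ 2 - 1%:M.
Definition defect2 := initial2 ^+ 2 - 1%:M.

(** The moments of the shift at the origin: the squared norm of
    T_1^m T_2^n (e_(0,0) (x) h) is <D(m,n) h, h>. *)
Definition moment (p : nat * nat) := defect1 *+ p.1 + defect2 *+ p.2 + 1%:M.
Definition sqrt_moment p := sqrtmx (moment p).
Implicit Types (v : 'cV[R[i]]_2) (p : nat * nat).

Lemma mx22_nat (a b c e : nat) (M : 'M[R[i]]_2) : M = mx22 a%:R b%:R c%:R e%:R ->
  forall v, M *m v = cv2 (a%:R * v 0 0 + b%:R * v 1 0) (c%:R * v 0 0 + e%:R * v 1 0).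
Proof. by move=> -> v; rewrite {1}[v]cv2_eta mx22_cv2. Qed.

Lemma defect1E : defect1 = mx22 0%:R 0%:R 0%:R 3%:R.
Proof.
rewrite /defect1 /initial1 expr2 -mulmxE mulmx22.
by apply/matrixP; elim/ord2P; elim/ord2P; rewrite !mxE /=; ring.
Qed.

Lemma defect2E : defect2 = mx22 4%:R 4%:R 4%:R 4%:R.
Proof.
rewrite /defect2 /initial2 expr2 -mulmxE mulmx22.
by apply/matrixP; elim/ord2P; elim/ord2P; rewrite !mxE /=; ring.
Qed.

Lemma momentE m n : moment (m, n) =
  mx22 (1 + 4 * n)%N%:R (4 * n)%N%:R (4 * n)%N%:R (1 + 3 * m + 4 * n)%N%:R.
Proof.
rewrite /moment defect1E defect2E.
by apply/matrixP; elim/ord2P; elim/ord2P; rewrite !(mxE, mulmxnE) /=; ring.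
Qed.

Lemma sqnorm2 v : sqnorm v = complex.Re (v 0 0) ^+ 2 + complex.Im (v 0 0) ^+ 2
  + (complex.Re (v 1 0) ^+ 2 + complex.Im (v 1 0) ^+ 2).
Proof.
rewrite sqnormE !big_ord_recl big_ord0 addr0.
by congr (_ + (complex.Re (v _ _) ^+ 2 + complex.Im (v _ _) ^+ 2)); apply/val_inj.
Qed.

Lemma form_defect1 v : cdot (defect1 *m v) v =
  (3 * (complex.Re (v 1 0) ^+ 2 + complex.Im (v 1 0) ^+ 2))%:C%C.
Proof.
rewrite (mx22_nat defect1E) cdot2 !mxE /= -!(rmorph_nat (real_complex R)).
case: (v 0 0) (v 1 0) => a b [c e]; apply/eqP; rewrite eq_complex /=.
by apply/andP; split; apply/eqP; ring.
Qed.

Lemma form_defect2 v : cdot (defect2 *m v) v =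
  (4 * ((complex.Re (v 0 0) + complex.Re (v 1 0)) ^+ 2 +
        (complex.Im (v 0 0) + complex.Im (v 1 0)) ^+ 2))%:C%C.
Proof.
rewrite (mx22_nat defect2E) cdot2 !mxE /= -!(rmorph_nat (real_complex R)).
case: (v 0 0) (v 1 0) => a b [c e]; apply/eqP; rewrite eq_complex /=.
by apply/andP; split; apply/eqP; ring.
Qed.

Definition defect (j : 'I_2) : 'M[R[i]]_2 := if j == 0 then defect1 else defect2.

(** The eigenvalues of the two defects are 0 and 3, respectively 0 and 8. *)
Lemma defect_bounds j v :
  0 <= cdot (defect j *m v) v /\ complex.Re (cdot (defect j *m v) v) <= 8 * sqnorm v.
Proof.
rewrite /defect sqnorm2; case: ifP => _;
  [rewrite form_defect1|rewrite form_defect2]; rewrite ler0c /=;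
  case: (v 0 0) (v 1 0) => a b [c e] /=; split; rewrite ?mulr_ge0 ?addr_ge0 ?sqr_ge0//.
  by have := sqr_ge0 a; have := sqr_ge0 b; have := sqr_ge0 c; have := sqr_ge0 e; lra.
by have := sqr_ge0 (a - c); have := sqr_ge0 (b - e); lra.
Qed.

Lemma moment_step j p : moment (step j p) = moment p + defect j.
Proof.
rewrite /moment /step /defect; move: defect1 defect2 => A B; case: ifP => _ /=.
  by rewrite mulrS -!addrA [LHS]addrC -!addrA.
by rewrite mulrSr -!addrA (addrC B).
Qed.

Lemma moment_affine i j p :
  moment p - moment (step i p) - moment (step j p) + moment (step i (step j p)) = 0.
Proof.
rewrite !moment_step; move: (moment p) (defect i) (defect j) => M X Y.
by apply/matrixP => a b; rewrite !mxE; ring.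
Qed.

Lemma moment_form_step j p v :
  cdot (moment (step j p) *m v) v = cdot (moment p *m v) v + cdot (defect j *m v) v.
Proof.
by rewrite moment_step; move: (moment p) (defect j) => M X; rewrite mulmxDl cdot_addl.
Qed.

Lemma moment_ge j p v :
  complex.Re (cdot (moment p *m v) v) <= complex.Re (cdot (moment (step j p) *m v) v).
Proof.
have [i0 _] := defect_bounds j v; rewrite moment_form_step raddfD lerDl.
by move: i0; rewrite lecE => /andP[].
Qed.

Lemma moment00 : moment (0, 0)%N = 1%:M.
Proof. by rewrite /moment !mulr0n !add0r. Qed.

Lemma moment_pos p :
  posmx (moment p) /\ forall v, sqnorm v <= complex.Re (cdot (moment p *m v) v).
Proof.
pose ge1 (M : 'M[R[i]]_2) :=
  posmx M /\ forall v, sqnorm v <= complex.Re (cdot (M *m v) v).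
have stepP j q : ge1 (moment q) -> ge1 (moment (step j q)).
  move=> [P1 P2]; split=> v; last exact: le_trans (P2 v) (moment_ge j q v).
  by rewrite moment_form_step addr_ge0// (defect_bounds j v).1.
case: p => m n; elim: m => [|m]; last exact: (stepP 0).
elim: n => [|n]; last exact: (stepP 1).
by rewrite moment00; split=> v; rewrite mul1mx// cdotvv ler0c sqnorm_ge0.
Qed.

(** As I <= D, the increment is at most 8 I <= 8 D, which bounds the weights by 3. *)
Lemma moment_le j p v :
  complex.Re (cdot (moment (step j p) *m v) v) <= 3 ^+ 2 * complex.Re (cdot (moment p *m v) v).
Proof.
have [_ h] := defect_bounds j v; have [_ /(_ v) h'] := moment_pos p.
rewrite moment_form_step raddfD /=; move: h h' => /=; lra.
Qed.

(** The trace of D(m,n) is 2 + 3 m + 8 n, its determinant 1 + 3 m + 8 n + 12 m n. *)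
Lemma sqrt_momentP p : posmx (sqrt_moment p) /\ sqrt_moment p *m sqrt_moment p = moment p.
Proof.
apply: sqrtmxP; case: p => m n.
have d0 : 0 <= 1 + 3 * m%:R + 8 * n%:R + 12 * m%:R * n%:R :> R.
  by rewrite !addr_ge0 ?mulr_ge0.
apply: (@sqrtmx_exists _ _ _ (2 + 3 * m%:R + 8 * n%:R)
  (Num.sqrt (1 + 3 * m%:R + 8 * n%:R + 12 * m%:R * n%:R))).
- exact: (moment_pos _).1.
- exact: sqrtr_ge0.
- by rewrite ltr_wpDr ?mulr_ge0 ?sqrtr_ge0// ltr_wpDr ?mulr_ge0// ltr_wpDr ?mulr_ge0.
rewrite sqr_sqrtr// momentE mulmx22.
by apply/matrixP; elim/ord2P; elim/ord2P;
  rewrite !mxE !(rmorphD, rmorphM, rmorph1, rmorph_nat) /=; ring.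
Qed.

Lemma sqrt_moment_unit p : sqrt_moment p \in unitmx.
Proof.
have momentU : moment p \in unitmx.
  rewrite -unitmx_tr -row_free_unit; apply: inj_row_free => r rD.
  apply: trmx_inj; rewrite trmx0; apply: sqnorm_eq0; apply/eqP.
  rewrite eq_le sqnorm_ge0 andbT; apply: le_trans ((moment_pos p).2 _) _.
  by rewrite -[moment p]trmxK -trmx_mul rD trmx0 cdot_0l.
by move: momentU; rewrite -(sqrt_momentP p).2 unitmx_mul => /andP[].
Qed.

Lemma sqrt_moment_eigen p v (l : R) : 0 < l ->
  moment p *m v = (l ^+ 2)%:C%C *: v -> sqrt_moment p *m v = l%:C%C *: v.
Proof.
move=> l0 Mv; have [Qp QQ] := sqrt_momentP p.
by apply: posmx_eigen => //; rewrite mulmxA QQ.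
Qed.

Lemma sqrt_moment00 : sqrt_moment (0, 0)%N = 1%:M.
Proof.
apply: mulmx_ext => v; rewrite (@sqrt_moment_eigen _ _ 1)// ?mul1mx ?scale1r//.
by rewrite moment00 mul1mx expr1n scale1r.
Qed.

Lemma sqrt_moment_e0 n : sqrt_moment (n, 0)%N *m cv2 1 0 = cv2 1 0.
Proof.
rewrite (@sqrt_moment_eigen _ _ 1) ?scale1r//.
rewrite expr1n scale1r momentE mx22_cv2 !mulr0 !mulr1 !addr0.
by rewrite muln0 addn0.
Qed.

Lemma sqrt_moment10 : sqrt_moment (1, 0)%N = initial1.
Proof.
have h1 := sqrt_moment_e0 1.
have h2 : sqrt_moment (1, 0)%N *m cv2 0 1 = 2 *: cv2 0 1.
  rewrite (@sqrt_moment_eigen _ _ 2)// ?rmorph_nat//.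
  rewrite momentE mx22_cv2 scale_cv2 rmorphXn rmorph_nat.
  by congr cv2; rewrite !(muln0, addn0, muln1); ring.
apply: mulmx_ext => v; rewrite {1}[v]cv2_eta.
rewrite [RHS](mx22_nat (erefl : initial1 = mx22 1%:R 0%:R 0%:R 2%:R)).
have -> : cv2 (v 0 0) (v 1 0) = v 0 0 *: cv2 1 0 + v 1 0 *: cv2 0 1.
  by apply/matrixP; elim/ord2P => j; rewrite !mxE /=; ring.
rewrite mulmxDr -!scalemxAr h1 h2.
by apply/matrixP; elim/ord2P => j; rewrite !mxE /=; ring.
Qed.

Lemma sqrt_moment01 : sqrt_moment (0, 1)%N = initial2.
Proof.
have h1 : sqrt_moment (0, 1)%N *m cv2 1 1 = 3 *: cv2 1 1.
  rewrite (@sqrt_moment_eigen _ _ 3)// ?rmorph_nat//.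
  rewrite momentE mx22_cv2 scale_cv2 rmorphXn rmorph_nat.
  by congr cv2; rewrite !(muln0, addn0, muln1); ring.
have h2 : sqrt_moment (0, 1)%N *m cv2 1 (-1) = cv2 1 (-1).
  rewrite (@sqrt_moment_eigen _ _ 1) ?scale1r//.
  rewrite momentE mx22_cv2 scale_cv2 rmorphXn rmorph1.
  by congr cv2; rewrite !(muln0, addn0, muln1); ring.
apply: mulmx_ext => v; rewrite {1}[v]cv2_eta.
rewrite [RHS](mx22_nat (erefl : initial2 = mx22 2%:R 1%:R 1%:R 2%:R)).
have -> : cv2 (v 0 0) (v 1 0) =
    ((v 0 0 + v 1 0) / 2) *: cv2 1 1 + ((v 0 0 - v 1 0) / 2) *: cv2 1 (-1).
  by apply/matrixP; elim/ord2P => j; rewrite !mxE /=; field.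
rewrite mulmxDr -!scalemxAr h1 h2.
by apply/matrixP; elim/ord2P => j; rewrite !mxE /=; field.
Qed.

Lemma sqnorm_sqrtV_moment p v :
  sqnorm (invmx (sqrt_moment p) *m (moment p *m v)) =
  complex.Re (cdot (moment p *m v) v).
Proof.
have [Qp QQ] := sqrt_momentP p; rewrite -{1}QQ -mulmxA mulKmx ?sqrt_moment_unit//.
by rewrite /sqnorm -QQ -mulmxA [in RHS]cdot_ctr posmx_herm.
Qed.

(** The squared norm of Q^-1 e_1 is <u, e_1> for the solution u of D u = e_1. *)
Lemma sqnorm_sqrtV_e0 p (x : R) y :
  moment p *m cv2 x%:C%C y = cv2 1 0 -> sqnorm (invmx (sqrt_moment p) *m cv2 1 0) = x.
Proof. by move=> e; rewrite -e sqnorm_sqrtV_moment e cdot2 !mxE /= mul0r addr0 mul1r. Qed.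

Lemma sqnorm_sqrtV_e0_01 : sqnorm (invmx (sqrt_moment (0, 1)%N) *m cv2 1 0) = 5 / 9.
Proof.
apply: (@sqnorm_sqrtV_e0 _ _ (- (4 / 9))); rewrite momentE mx22_cv2.
by rewrite rmorphM fmorphV !rmorph_nat; congr cv2; field.
Qed.

Lemma sqnorm_sqrtV_e0_11 : sqnorm (invmx (sqrt_moment (1, 1)%N) *m cv2 1 0) = 1 / 3.
Proof.
apply: (@sqnorm_sqrtV_e0 _ _ (- (1 / 6))); rewrite momentE mx22_cv2.
by rewrite rmorphM fmorphV !rmorph_nat; congr cv2; field.
Qed.

End Example.

Theorem mainTheorem3 (R : realType) :
  let C1 : 'M[R[i]]_2 := mx22 1 0
                              0 2 in
  let C2 : 'M[R[i]]_2 := mx22 2 1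
                              1 2 in
  let A := C1 ^+ 2 - 1%:M in
  let B := C2 ^+ 2 - 1%:M in
  let D (m n : nat) := A *+ m + B *+ n + 1%:M in
  let W1 (m n : nat) := sqrtmx (D m.+1 n) *m invmx (sqrtmx (D m n)) in
  let W2 (m n : nat) := sqrtmx (D m n.+1) *m invmx (sqrtmx (D m n)) in
  (exists T, weighted_shift W1 W2 T) /\
  forall T, weighted_shift W1 W2 T ->
    [/\ toral_2isometry T,
        W1 0%N 0%N = C1 /\ W2 0%N 0%N = C2,
        posmx (W1 0%N 0%N) /\ posmx (W2 0%N 0%N),
        W1 0%N 0%N *m W2 0%N 0%N <> W2 0%N 0%N *m W1 0%N 0%N &
        ~ jointly_subnormal (cauchy_dual T)].
Proof.
move=> C1 C2 A B D W1 W2.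
have Qherm p : ctrmx (@sqrt_moment R p) = sqrt_moment p.
  exact: posmx_herm (sqrt_momentP p).1.
have QQ p : sqrt_moment p *m sqrt_moment p = @moment R p := (sqrt_momentP p).2.
have Qunit := @sqrt_moment_unit R.
have W1E : W1 0%N 0%N = C1.
  rewrite -[LHS]/(sqrt_moment (1, 0)%N *m invmx (sqrt_moment (0, 0)%N)).
  by rewrite sqrt_moment00 invmx1 mulmx1 sqrt_moment10.
have W2E : W2 0%N 0%N = C2.
  rewrite -[LHS]/(sqrt_moment (0, 1)%N *m invmx (sqrt_moment (0, 0)%N)).
  by rewrite sqrt_moment00 invmx1 mulmx1 sqrt_moment01.
split.
  have c1 : 1 <= 3 :> R by rewrite ler1n.
  have [T [Tb TE]] := exists_block_shift Qherm QQ Qunit c1 (@moment_le R).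
  by exists T; split=> [//|m n h|m n h]; [exact: (TE 0)|exact: (TE 1)].
move=> T [Tb T0 T1].
have TE : block_shift (@sqrt_moment R) T.
  by move=> j [m n] h; elim/ord2P: j; [exact: T0|exact: T1].
split=> //.
- exact: (block_shift_toral Qherm QQ Qunit (@moment_affine R) Tb TE).
- rewrite W1E W2E -[C1]sqrt_moment10 -[C2]sqrt_moment01.
  by split; exact: (sqrt_momentP _).1.
- rewrite W1E W2E !mulmx22 => /matrixP/(_ 0 1); rewrite !mxE /=.
  rewrite !(mul0r, mul1r, mulr1, mulr0, addr0, add0r).
  by move=> /(congr1 (@complex.Re R)) /=; lra.
- apply: (cauchy_dual_not_subnormal Qherm QQ Qunit (@moment_ge R) Tb TE
    (h := cv2 1 0)).
  + exact: sqrt_moment_e0.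
  + by rewrite sqnorm_sqrtV_e0_11 sqnorm_sqrtV_e0_01; lra.
Qed.
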